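(* Let $W\subset\mathbb Z^+$. For any nonnegative integer $l$ and any composition $\nu$ with $|\nu|=2n$, $$\{T^{O}_l(M):M\in\mathcal M^{O}_W(\nu;0),\ \ell_{WW}(M)\le l\}$$ is a basis of $\Pi(\nu)F_{2n}(O(l))$ (i.e. the elements $T^O_l(M)$ indexed by these multisets are linearly independent and span).
   Context: A composition $\nu=(\nu_1,\nu_2,\ldots)$ is a finite sequence of nonnegative integers, $|\nu|=\sum\nu_i$; its blocks are $S(\nu)_i=\{j:\sum_{k<i}\nu_k<j\le\sum_{k\le i}\nu_k\}\subset\{1,\ldots,|\nu|\}$. For $S\subset\{1,\ldots,N\}$, in $\mathbb C[S_N]$ put $E_S=\sum_\pi\mathrm{sgn}(\pi)\pi$, $H_S=\sum_\pi\pi$, sums over $\pi\in S_N$ fixing every $x\notin S$. $\Pi(\nu)=\prod_{i\in W}E_{S(\nu)_i}\prod_{i\notin W}H_{S(\nu)_i}$. $F_{2n}(O(l))$ is the space of vectors in $(\mathbb C^l)^{\otimes2n}$ fixed by $U^{\otimes2n}$ for all $U\in O(l)$. $\mathbb C[S_{2n}]$ acts on $(\mathbb C^l)^{\otimes 2n}$ through $T_l(\pi)(v_1\otimes\cdots\otimes v_{2n})=v_{\pi(1)}\otimes\cdots\otimes v_{\pi(2n)}$ (extended linearly), and $\Pi(\nu)F_{2n}(O(l))$ is the image of $F_{2n}(O(l))$ under $T_l(\Pi(\nu))$. For a fixed-point-free involution $\tau\in S_{2n}$, the basic invariant is $T^O_l(\tau)=\sum e_{w_1}\otimes\cdots\otimes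 e_{w_{2n}}$, the sum over all $w\in\{1,\ldots,l\}^{2n}$ with $w_k=w_{\tau(k)}$ for all $k$; these satisfy $T_l(\pi)T^O_l(\tau)=T^O_l(\pi^{-1}\tau\pi)$ and span $F_{2n}(O(l))$. A multiset $M$ on $\mathbb Z^+\times\mathbb Z^+$ is symmetric if invariant under $(x,y)\mapsto(y,x)$, and $(W,W)$-compatible if $(i,j)$ has multiplicity at most $1$ whenever exactly one of $i,j$ lies in $W$. The number of fixed points of $M$ is the number of elements $(i,i)$ with $i\in W$ (with multiplicity) plus the number of $i\notin W$ such that $(i,i)$ has odd multiplicity. $\mathcal M^O_W(\nu;a)$ is the set of symmetric $(W,W)$-compatible finite multisets in which each $i$ appears $\nu_i$ times as a first coordinate, with exactly $a$ fixed points. For $M\in\mathcal M^O_W(\nu;0)$, choose a fixed-point-free involution $\tau\in S_{2n}$ such that $M$ is the multiset of pairs $(i,j)$, one for each $k\in\{1,\ldots,2n\}$, with $k\in S(\nu)_i$, $\tau(k)\in S(\nu)_j$; then $T^O_l(M):=T_l(\Pi(\nu))T^O_l(\tau)$, well-defined up to sign (fix any choice). A $(W,W)$-increasing sequence is a sequence $(x_i,y_i)$ with $x_i\le x_{i+1}$, $y_i\le y_{i+1}$, where $x_i=x_{i+1}$ only if $x_i\in W$ and $y_i=y_{i+1}$ only if $y_i\in W$. $\ell_{WW}(M)$ is the length of the longest $(W,W)$-increasing sequence of elements of $M$, each used at most as often as its multiplicity. *)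

(* Defs.v *)
From HB Require Import structures.
From mathcomp Require Import all_boot all_order all_algebra all_fingroup.
From mathcomp Require Import finmap multiset complex.
From mathcomp Require Import boolp reals.

Set Implicit Arguments.
Unset Strict Implicit.
Unset Printing Implicit Defensive.

Import GRing.Theory.

Local Open Scope fset_scope.
Local Open Scope mset_scope.
Local Open Scope ring_scope.

(* Positive integers are shifted by one throughout: [i : nat] stands for
   i + 1 in Z^+, and the position [k : 'I_N] for k + 1 in {1, ..., N}.  Thus
   [nth 0 nu i] is nu_(i+1), and [W : {pred nat}] is a subset of Z^+.  The
   complex field is [R[i]] for [R : realType]. *)

Section Blocks.

Variable N : nat.

Definition block (nu : seq nat) (i : nat) : {set 'I_N} :=
  [set k : 'I_N | (sumn (take i nu) <= k < sumn (take i.+1 nu))%N].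

Definition fpf_involution (tau : 'S_N) : Prop :=
  forall k, tau (tau k) = k /\ tau k != k.

Definition represents (nu : seq nat) (tau : 'S_N) (M : {mset nat * nat}) :=
  fpf_involution tau /\
  forall i j, M (i, j) = #|[set k in block nu i | tau k \in block nu j]|.

End Blocks.

Section GroupAlgebra.

Variables (C : fieldType) (N : nat).

(* MathComp's pointwise ring structure on finite functions is not the one of
   the group algebra; only its C-module structure is used here. *)
Definition galg := {ffun 'S_N -> C^o}.

Definition gelt (s : 'S_N) : galg := [ffun t => (t == s)%:R].

(* The product [s * t] of 'S_N applies s first.  With this convention the
   action [galg_act] below is a left action; the opposite convention gives the
   same [Pi], since the factors of [Pi] commute. *)
Definition gmul (a b : galg) : galg :=
  \sum_(s : 'S_N) \sum_(t : 'S_N) (a s * b t : C) *: gelt (s * t)%g.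

Definition Esym (S : {set 'I_N}) : galg :=
  \sum_(s : 'S_N | perm_on S s) (-1 : C) ^+ odd_perm s *: gelt s.

Definition Hsym (S : {set 'I_N}) : galg :=
  \sum_(s : 'S_N | perm_on S s) gelt s.

Definition Pi (W : {pred nat}) (nu : seq nat) : galg :=
  gmul (\big[gmul/gelt 1%g]_(0 <= i < size nu | i \in W) Esym (block N nu i))
       (\big[gmul/gelt 1%g]_(0 <= i < size nu | i \notin W)
          Hsym (block N nu i)).

End GroupAlgebra.

Section Tensors.

Variables (C : fieldType) (l N : nat).

(* (C^l)^{(x) N} in coordinates: [t w] is the coefficient of
   e_(w_1) (x) ... (x) e_(w_N). *)
Definition tensor := {ffun {ffun 'I_N -> 'I_l} -> C^o}.

Definition pure (v : 'I_N -> 'cV[C]_l) : tensor :=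
  [ffun w : {ffun 'I_N -> 'I_l} => \prod_k v k (w k) 0].

Definition e_ (i : 'I_l) : 'cV[C]_l := delta_mx i 0.

(* The linear maps characterised by [mx_actE] and [perm_actE]. *)
Definition mx_act (U : 'M[C]_l) (t : tensor) : tensor :=
  \sum_(w : {ffun 'I_N -> 'I_l}) (t w : C) *: pure (fun k => U *m e_ (w k)).

Definition perm_act (s : 'S_N) (t : tensor) : tensor :=
  \sum_(w : {ffun 'I_N -> 'I_l}) (t w : C) *: pure (fun k => e_ (w (s k))).

Definition galg_act (a : galg C N) (t : tensor) : tensor :=
  \sum_(s : 'S_N) (a s : C) *: perm_act s t.

Definition TO (tau : 'S_N) : tensor :=
  \sum_(w : {ffun 'I_N -> 'I_l} | [forall k, w k == w (tau k)])
     pure (fun k => e_ (w k)).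

Lemma pure_e (w w' : {ffun 'I_N -> 'I_l}) :
  pure (fun k => e_ (w k)) w' = (w' == w)%:R.
Proof.
rewrite ffunE; under eq_bigr do rewrite mxE eqxx andbT.
case: eqVneq => [->|ne]; first by rewrite big1 // => k _; rewrite eqxx.
have [k nek]: exists k, w' k != w k.
  apply/existsP; rewrite -negb_forall; apply: contra ne => /forallP eqw.
  by apply/eqP/ffunP => k; apply/eqP.
by rewrite (bigD1 k) //= (negbTE nek) mul0r.
Qed.

Lemma mx_actE (U : 'M[C]_l) (v : 'I_N -> 'cV[C]_l) :
  mx_act U (pure v) = pure (fun k => U *m v k).
Proof.
apply/ffunP => w; rewrite /mx_act sum_ffunE !ffunE.
under [RHS]eq_bigr do rewrite mxE.
rewrite bigA_distr_bigA /=; apply: eq_bigr => w' _.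
rewrite !ffunE /GRing.scale /= -big_split /=; apply: eq_bigr => k _.
rewrite -colE mxE.
exact: mulrC.
Qed.

Lemma perm_actE (s : 'S_N) (v : 'I_N -> 'cV[C]_l) :
  perm_act s (pure v) = pure (fun k => v (s k)).
Proof.
apply/ffunP => w; rewrite /perm_act sum_ffunE.
pose w0 : {ffun 'I_N -> 'I_l} := [ffun k => w ((s^-1)%g k)].
have pE (u : {ffun 'I_N -> 'I_l}) :
    pure (fun k => e_ (u (s k))) w = (u == w0)%:R.
  have -> : pure (fun k => e_ (u (s k))) =
            pure (fun k => e_ ([ffun k => u (s k)] k)).
    by rewrite /pure; apply/eq_ffun => ?; apply: eq_bigr => k _; rewrite ffunE.
  rewrite pure_e; congr (nat_of_bool _)%:R; apply/eqP/eqP => [wE|->].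
    by apply/ffunP => k; rewrite ffunE wE ffunE permKV.
  by apply/ffunP => k; rewrite !ffunE permK.
rewrite (bigD1 w0) //= big1 ?addr0 => [|u neu]; last first.
  by rewrite [LHS]ffunE pE (negbTE neu) scaler0.
rewrite [LHS]ffunE pE eqxx /GRing.scale /= mulr1 !ffunE.
rewrite (reindex_inj (@perm_inj _ s)) /=.
by apply: eq_bigr => k _; rewrite ffunE permK.
Qed.

End Tensors.

Section Invariants.

Variables (R : realType) (l N : nat).

(* The real orthogonal group, acting on the complex tensor power. *)
Definition FO (t : tensor R[i] l N) : Prop :=
  forall U : 'M[R]_l, U *m U^T = 1%:M ->
    mx_act (map_mx (real_complex R) U) t = t.

Definition PiFO (W : {pred nat}) (nu : seq nat) (t : tensor R[i] l N) : Prop :=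
  exists2 u, FO u & t = galg_act (Pi R[i] N W nu) u.

Definition TOM (W : {pred nat}) (nu : seq nat)
    (tau : {mset nat * nat} -> 'S_N) (M : {mset nat * nat}) :
    tensor R[i] l N :=
  galg_act (Pi R[i] N W nu) (TO R[i] l (tau M)).

End Invariants.

Section Multisets.

Variable W : {pred nat}.

Definition symmetric_mset (M : {mset nat * nat}) : Prop :=
  forall i j, M (i, j) = M (j, i).

Definition compatible_mset (M : {mset nat * nat}) : Prop :=
  forall i j, (i \in W) != (j \in W) -> (M (i, j) <= 1)%N.

(* [count] over [M] counts multiplicities, over [finsupp M] it does not. *)
Definition fixed_points (M : {mset nat * nat}) : nat :=
  (count (fun p => (p.1 == p.2) && (p.1 \in W)) M
   + count (fun p => [&& p.1 == p.2, p.1 \notin W & odd (M p)])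
       (finsupp M))%N.

Definition MO (nu : seq nat) (a : nat) (M : {mset nat * nat}) : Prop :=
  [/\ symmetric_mset M,
      compatible_mset M,
      forall i, count (fun p => p.1 == i) M = nth 0%N nu i
    & fixed_points M = a].

Definition WW_step (p q : nat * nat) : bool :=
  [&& (p.1 <= q.1)%N, (p.2 <= q.2)%N,
      (p.1 == q.1) ==> (p.1 \in W) & (p.2 == q.2) ==> (p.2 \in W)].

Definition WW_increasing_in (M : {mset nat * nat}) (s : seq (nat * nat)) :=
  sorted WW_step s /\ forall p, (count_mem p s <= M p)%N.

(* A sequence using each element at most as often as its multiplicity has
   length at most [size M], so the bound on [k] excludes nothing. *)
Definition ell (M : {mset nat * nat}) : nat :=
  \max_(k < (size M).+1 |
          `[< exists2 s, WW_increasing_in M s & size s = k >]) k.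

End Multisets.

Local Open Scope nat_scope.

Lemma in_block N nu (k : 'I_N) i : (k < sumn nu)%N ->
  (k \in block N nu i) = (reshape_index nu k == i).
Proof.
rewrite inE; move: (k : nat) => {}k.
elim: nu i k => [|a nu IH] i k //=.
rewrite {1}/reshape_index /= subn_eq0 => lt_k.
case: (ltnP k a) => ka.
  case: i => [|i] /=; first by rewrite take0 /= addn0 ka.
  by rewrite leqNgt (leq_trans ka (leq_addr _ _)).
case: i => [|i] /=; first by rewrite take0 /= addn0 ltnNge ka.
rewrite eqSS subSn // -/(reshape_index nu (k - a)) -IH; last by rewrite ltn_subLR.
by rewrite leq_subRL // ltn_subLR.
Qed.

Lemma MO_even W nu M i : MO W nu 0 M -> ~~ odd (M (i, i)).
Proof.
move=> [_ _ _ /eqP]; rewrite addn_eq0 => /andP[/eqP c1 /eqP c2].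
apply/negP => oM.
have Mi : (i, i) \in M by rewrite in_mset; case: (M _) oM.
have [iW|iW] := boolP (i \in W).
  have : has (fun p => (p.1 == p.2) && (p.1 \in W)) M.
    by apply/hasP; exists (i, i) => //=; rewrite eqxx iW.
  by rewrite has_count c1.
have : has (fun p => [&& p.1 == p.2, p.1 \notin W & odd (M p)]) (finsupp M).
  by apply/hasP; exists (i, i) => /=; rewrite ?msuppE ?eqxx ?iW.
by rewrite has_count c2.
Qed.

Lemma MO_layout W nu M N : sumn nu = N -> MO W nu 0 M ->
  exists p : 'I_N -> nat * nat,
    (forall k i, (k \in block N nu i) = ((p k).1 == i)) /\
    forall x, #|[set k | p k == x]| = M x.
Proof.
move=> <- [_ _ rows _].
pose ss := [seq [seq p <- M | p.1 == i] | i <- iota 0 (size nu)].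
have sh : shape ss = nu.
  apply: (@eq_from_nth _ 0%N); rewrite /ss /shape !size_map size_iota // => i Hi.
  by rewrite -map_comp (nth_map 0%N) ?size_iota //= nth_iota // size_filter rows.
have sz : size (flatten ss) = sumn nu by rewrite size_flatten sh.
pose p (k : 'I_(sumn nu)) := nth (0, 0)%N (flatten ss) k.
exists p; split=> [k i|x].
  rewrite in_block //; congr (_ == i).
  rewrite /p nth_flatten sh.
  have Hr : (reshape_index nu k < size nu)%N by exact: reshape_indexP.
  have Ho : (reshape_offset nu k < nth 0 nu (reshape_index nu k))%N by exact: reshape_offsetP.
  rewrite (nth_map 0%N) ?size_iota // nth_iota //.
  set t := [seq _ <- _ | _].
  have : nth (0, 0)%N t (reshape_offset nu k) \in t.
    by rewrite mem_nth // size_filter rows.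
  by rewrite mem_filter => /andP[/eqP->].
have -> : #|[set k | p k == x]| = count_mem x (flatten ss).
  have -> : flatten ss = map p (enum 'I_(sumn nu)).
    apply: (@eq_from_nth _ (0,0)%N); first by rewrite size_map size_enum_ord.
    move=> k; rewrite sz => Hk; rewrite (nth_map (Ordinal Hk)) ?size_enum_ord //.
    by rewrite /p nth_enum_ord.
  by rewrite count_map cardsE cardE enumT /enum_mem size_filter; apply: eq_count.
rewrite count_flatten -map_comp.
have cE i : count_mem x [seq p0 <- M | p0.1 == i] = if x.1 == i then M x else 0.
  rewrite count_filter -count_mem_mset; case: ifP => xi.
    by apply: eq_count => y /=; case: eqP => // ->.
  by rewrite (@eq_count _ _ pred0) ?count_pred0 // => y /=; case: eqP => // ->.
rewrite (eq_map cE) sumn_map /index_iota -{1}[size nu]subn0 -/(index_iota 0 (size nu)).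
rewrite -big_mkcond /= big_mkord.
have [lx|gx] := ltnP x.1 (size nu).
  by rewrite (big_pred1 (Ordinal lx)) // => k; rewrite -val_eqE /= eq_sym.
rewrite big1 => [|k /eqP e]; last by move: (ltn_ord k); rewrite -e ltnNge gx.
apply/esym/eqP; rewrite mset_eq0; apply/negP => xM.
have : has (fun p => p.1 == x.1) M by apply/hasP; exists x.
by rewrite has_count rows nth_default.
Qed.

(* Every multiset of [MO W nu 0] admits an involution to be used for [TOM]. *)
Lemma represents_exists W nu M N : sumn nu = N -> MO W nu 0 M ->
  exists tau : 'S_N, represents nu tau M.
Proof.
move=> sN MM; have [p [pb pM]] := MO_layout sN MM.
have [sym _ _ _] := MM.
pose sw (x : nat * nat) := (x.2, x.1).
have swK x : sw (sw x) = x by case: x.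
have Msw x : M (sw x) = M x by case: x => i j; exact: sym.
pose A x := enum [set k | p k == x].
have sA x : size (A x) = M x by rewrite /A -cardE.
have AP x k : (k \in A x) = (p k == x) by rewrite mem_enum inE.
pose g (x : nat * nat) m := if x.1 == x.2 then if odd m then m.-1 else m.+1 else m.
have gK x : involutive (g x).
  rewrite /g => m; case: (x.1 == x.2) => //; case om: (odd m) => /=.
    by case: m om => //= m /negbTE ->.
  by rewrite om.
have gsw x m : g (sw x) m = g x m by rewrite /g /= eq_sym.
have glt x m : (m < M x -> g x m < M x)%N.
  rewrite /g; case: eqP => // e lt; case om: (odd m); first exact: leq_ltn_trans (leq_pred m) lt.
  rewrite ltn_neqAle lt andbT; apply/eqP => eM.
  have := MO_even x.1 MM; rewrite {2}e -surjective_pairing -eM /= om //.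
pose f k := nth k (A (sw (p k))) (g (p k) (index k (A (p k)))).
have ilt k : (index k (A (p k)) < M (p k))%N by rewrite -sA index_mem AP.
have fA k : f k \in A (sw (p k)) by rewrite mem_nth // sA Msw glt.
have pf k : p (f k) = sw (p k) by apply/eqP; rewrite -AP.
have fi k : index (f k) (A (sw (p k))) = g (p k) (index k (A (p k))).
  by rewrite index_uniq ?enum_uniq // sA Msw glt.
have fK : involutive f.
  move=> k; rewrite {1}/f pf fi swK gsw gK.
  by rewrite (set_nth_default k) ?sA // nth_index // AP.
exists (perm (inv_inj fK)); split=> [k|i j].
  rewrite !permE fK; split=> //; apply/eqP => e.
  have e1 : sw (p k) = p k by rewrite -pf e.
  have := fi k; rewrite e e1 /g.
  have -> : (p k).1 == (p k).2 by rewrite -{2}e1.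
  case: (index _ _) => [|m] //=; case: ifP => _.
    by move/esym/n_Sn.
  by move/n_Sn.
rewrite -pM; apply: eq_card => k; rewrite in_set [RHS]in_set permE !pb pf /=.
by case: (p k) => a b; rewrite xpair_eqE.
Qed.

Local Close Scope nat_scope.

(* The family [f], indexed by the elements satisfying [P], is a basis of the
   subspace [U]; linear independence is that of the indexed family, so [f] is
   in particular injective on [P]. *)
Definition is_family_basis (K : fieldType) (V : vectType K) (I : choiceType)
    (P : I -> Prop) (f : I -> V) (U : V -> Prop) : Prop :=
  (forall s : seq I, uniq s -> (forall i, i \in s -> P i) -> free (map f s)) /\
  (forall v : V, U v <->
     exists2 s : seq I, (forall i, i \in s -> P i) & v \in <<map f s>>%VS).

(* Main.v *)
(* First fundamental theorem: so(l)-invariance of a tensor t of degree N > 0,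
   contracted at each position, gives L t = (sum of the contractions of t,
   reinserted as cups), where L = N (l - 1) + (sum of the swaps over ordered
   pairs of positions).  Contractions of invariants are invariants of degree
   N - 2, so by induction L t lies in the span of the basic invariants; and L is
   positive definite on tensors supported on words in which each letter occurs
   an even number of times, a space containing all the O(l)-invariants.

   Write b for the block index and Phi(tau) = sum_k b(k) b(tau k).  Spanning:
   a (W,W)-increasing sequence of length l + 1 gives l + 1 positions whose
   antisymmetriser kills all tensors; by the rearrangement inequality each term
   of the resulting relation either has smaller Phi or equals the original one,
   sign included.  Independence: colour each position by the length of the
   longest chain ending there.  In a colour class the matching reverses the
   order of the blocks, so it is the unique minimiser of Phi among matchings
   that respect the colouring; the coefficients at these colourings therefore
   form a triangular system, and its diagonal entries do not vanish since all
   the permutations contributing to them have sign 1. *)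

From HB Require Import structures.
Require Import Defs.
From mathcomp Require Import all_boot all_order all_algebra all_fingroup.
From mathcomp Require Import finmap multiset complex.
From mathcomp Require Import boolp reals.
From mathcomp Require Import zify ring.

Set Implicit Arguments.
Unset Strict Implicit.
Unset Printing Implicit Defensive.

Import Order.TTheory GRing.Theory Num.Theory.

Local Open Scope fset_scope.
Local Open Scope mset_scope.
Local Open Scope ring_scope.

(** * Coefficients of tensors *)

Section TensorCoefficients.

Variables (C : fieldType) (l N : nat).

Local Notation word := {ffun 'I_N -> 'I_l}.
Local Notation tensor := (tensor C l N).
Local Notation T := (@TO C l N).

Definition perm_word (s : 'S_N) (w : word) : word := [ffun k => w (s k)].

Lemma perm_word1 w : perm_word 1%g w = w.
Proof. by apply/ffunP => k; rewrite ffunE perm1. Qed.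

Lemma perm_wordM s t w : perm_word (s * t)%g w = perm_word s (perm_word t w).
Proof. by apply/ffunP => k; rewrite !ffunE permM. Qed.

Lemma perm_word_bij s : bijective (perm_word s).
Proof.
by exists (perm_word s^-1) => w; rewrite -perm_wordM ?mulVg ?mulgV perm_word1.
Qed.

Lemma perm_act_coef s (t : tensor) w : perm_act s t w = t (perm_word s^-1 w).
Proof.
rewrite /perm_act sum_ffunE (bigD1 (perm_word s^-1 w)) //= big1 => [|u ne].
  rewrite addr0 [LHS]ffunE.
  have -> : pure (fun k => e_ C (perm_word s^-1 w (s k))) w
          = pure (fun k => e_ C (w k)) w.
    by rewrite !ffunE; apply: eq_bigr => k _; rewrite ffunE permK.
  by rewrite pure_e eqxx /GRing.scale /= mulr1.
rewrite [LHS]ffunE.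
have -> : pure (fun k => e_ C (u (s k))) w
        = pure (fun k => e_ C (perm_word s u k)) w.
  by rewrite !ffunE; apply: eq_bigr => k _; rewrite ffunE.
rewrite pure_e; case: eqP => [e|]; last by rewrite scaler0.
by case/eqP: ne; rewrite e -perm_wordM mulVg perm_word1.
Qed.

Lemma TO_coef (tau : 'S_N) (w : word) :
  T tau w = (perm_word tau w == w)%:R.
Proof.
rewrite /TO sum_ffunE.
under eq_bigr => u _ do rewrite pure_e.
have -> : (perm_word tau w == w) = [forall k, w k == w (tau k)].
  apply/eqP/forallP => [e k|e]; first by rewrite -{1}e ffunE.
  by apply/ffunP => k; rewrite ffunE (eqP (e k)).
rewrite big_mkcond (bigD1 w) //= eqxx big1 ?addr0 => [|u /negbTE ne].
  by case: ifP.
by rewrite eq_sym ne; case: ifP.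
Qed.

Lemma mx_act_coef (U : 'M[C]_l) (t : tensor) w :
  mx_act U t w = \sum_(w' : word) t w' * \prod_k U (w k) (w' k).
Proof.
rewrite /mx_act sum_ffunE; apply: eq_bigr => w' _.
rewrite 2!ffunE /GRing.scale /=; congr (_ * _); apply: eq_bigr => k _.
by rewrite -colE mxE.
Qed.

(** Products of permutations apply the left factor first, so this conjugate is $\pi^{-1}\tau\pi$ in
    the usual notation. *)
Lemma perm_act_TO s tau : perm_act s (T tau) = T (s * tau * s^-1)%g.
Proof.
apply/ffunP => w; rewrite perm_act_coef !TO_coef; congr (nat_of_bool _)%:R.
rewrite -[RHS](inj_eq (bij_inj (perm_word_bij s^-1))) -!perm_wordM.
by rewrite !mulgA mulVg mul1g.
Qed.

Lemma perm_act_is_linear s : linear (@perm_act C l N s).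
Proof. by move=> a u v; apply/ffunP => w; rewrite !(perm_act_coef, ffunE). Qed.

HB.instance Definition _ s :=
  GRing.isLinear.Build C tensor tensor _ (@perm_act C l N s)
    (perm_act_is_linear s).

Lemma perm_actM s t (u : tensor) :
  perm_act s (perm_act t u) = perm_act (s * t)%g u.
Proof.
by apply/ffunP => w; rewrite !perm_act_coef invMg perm_wordM.
Qed.

Lemma galg_act_is_linear a : linear (@galg_act C l N a).
Proof.
move=> c u v; rewrite /galg_act scaler_sumr -big_split /=; apply: eq_bigr => s _.
by rewrite linearP scalerDr !scalerA mulrC.
Qed.

HB.instance Definition _ a :=
  GRing.isLinear.Build C tensor tensor _ (@galg_act C l N a)
    (galg_act_is_linear a).

Lemma mx_act_is_linear U : linear (@mx_act C l N U).
Proof.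
move=> c u v; apply/ffunP => w; rewrite !(mx_act_coef, ffunE) scaler_sumr.
rewrite -big_split /=; apply: eq_bigr => w' _.
by rewrite !ffunE mulrDl /GRing.scale /= mulrA.
Qed.

HB.instance Definition _ U :=
  GRing.isLinear.Build C tensor tensor _ (@mx_act C l N U)
    (mx_act_is_linear U).

Definition coef (w : word) (t : tensor) : C^o := t w.

Lemma coef_is_linear w : linear (coef w).
Proof. by move=> c u v; rewrite /coef !ffunE. Qed.

HB.instance Definition _ w :=
  GRing.isLinear.Build C tensor C^o _ (coef w) (coef_is_linear w).

End TensorCoefficients.

(** * Linear maps on spans and on stable subspaces *)

Lemma linear_span_sub (K : fieldType) (V V' : vectType K) (f : {linear V -> V'})
    (X : seq V) (U : {vspace V'}) :
  (forall x, x \in X -> f x \in U) -> forall v, v \in <<X>>%VS -> f v \in U.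
Proof.
move=> fX v vX; rewrite -(lfunE f) memv_preim.
by apply: (subvP (_ : <<X>> <= _)%VS) vX; apply/span_subvP => x /fX;
  rewrite -memv_preim lfunE.
Qed.

(** Dimension count: an injective endomorphism of a finite-dimensional space is onto. *)
Lemma linear_stable_inj (K : fieldType) (V : vectType K) (f : {linear V -> V})
    (U : {vspace V}) :
  (forall u, u \in U -> f u \in U) -> (forall u, u \in U -> f u = 0 -> u = 0) ->
  forall v, v \in U -> exists2 u, u \in U & f u = v.
Proof.
move=> fU finj v vU.
have sub : (linfun f @: U <= U)%VS.
  by apply/subvP => _ /memv_imgP [u uU ->]; rewrite lfunE fU.
have dimE : \dim (linfun f @: U) = \dim U.
  apply: limg_dim_eq; apply/eqP; rewrite -subv0; apply/subvP => u.
  by rewrite memv_cap memv_ker lfunE memv0 => /andP[uU /eqP /(finj u uU) ->].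
have imgU : (linfun f @: U)%VS = U.
  by apply/eqP; rewrite -(dimv_leqif_eq sub) dimE.
have : v \in (linfun f @: U)%VS by rewrite imgU.
by case/memv_imgP => u uU ->; exists u; rewrite ?lfunE.
Qed.

(** * The first fundamental theorem for O(l) *)

Section OrthogonalFFT.

Variables (C : numClosedFieldType) (l N : nat).

Local Notation word := {ffun 'I_N -> 'I_l}.
Local Notation tensor := (tensor C l N).
Local Notation T := (@TO C l N).

Definition upd (w : word) k c : word := [ffun j => if j == k then c else w j].

Lemma upd_id w k : upd w k (w k) = w.
Proof. by apply/ffunP => j; rewrite ffunE; case: eqP => [->|]. Qed.

Lemma upd_at w k c : upd w k c k = c.
Proof. by rewrite ffunE eqxx. Qed.

Lemma upd_ne w k c j : j != k -> upd w k c j = w j.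
Proof. by rewrite ffunE => /negbTE ->. Qed.

Lemma upd_upd w k c d : upd (upd w k c) k d = upd w k d.
Proof. by apply/ffunP => j; rewrite !ffunE; case: eqP. Qed.

Lemma updC w k c m d : k != m ->
  upd (upd w k c) m d = upd (upd w m d) k c.
Proof.
move=> km; apply/ffunP => j; rewrite !ffunE.
by case: (j =P m) => // ->; rewrite eq_sym (negbTE km).
Qed.

Lemma upd_swap w k m : k != m ->
  upd (upd w k (w m)) m (w k) = perm_word (tperm k m) w.
Proof.
move=> km; apply/ffunP => j; rewrite !ffunE.
by case: tpermP => [->|->|/eqP/negbTE -> /eqP/negbTE ->]; rewrite ?eqxx // (negbTE km).
Qed.

Implicit Types (D : {set 'I_N}) (t u : tensor).

(** The elementary matrix $E_{ab}$ of gl(l), acting as a derivation on the positions in [D]. *)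
Definition raise D (a b : 'I_l) t (w : word) : C :=
  \sum_(k in D | w k == a) t (upd w k b).

(* Invariance under the Lie algebra so(l) acting on the positions in [D]. *)
Definition so_inv D t := forall a b w, raise D a b t w = raise D b a t w.

(** A tensor of degree [#|D|] is encoded as a tensor of degree [N] that ignores the letters outside
    [D]; contractions then stay within one type. *)
Definition dep_on D t :=
  forall w w' : word, {in D, w =1 w'} -> t w = t w'.

Definition even_on D t :=
  forall w : word, t w != 0 -> forall a, ~~ odd #|[set k in D | w k == a]|.

Definition matching D (s : 'S_N) :=
  [forall k, (s (s k) == k) && ((s k != k) == (k \in D))].

Definition contr k m t : tensor :=
  [ffun w : word => \sum_b t (upd (upd w k b) m b)].

Definition cup k m t : tensor := [ffun w : word => (w k == w m)%:R * t w].

(* Up to an additive constant, the Casimir operator of gl(l). *)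
Definition casimir D t : tensor :=
  \sum_(k in D) ((l%:R - 1 : C) *: t
     + \sum_(m in D | m != k) perm_act (tperm k m) t).

Lemma cup_is_linear k m : linear (cup k m).
Proof.
move=> c u v; apply/ffunP => w; rewrite !ffunE mulrDr; congr (_ + _).
exact: mulrCA.
Qed.

HB.instance Definition _ k m :=
  GRing.isLinear.Build C tensor tensor _ (cup k m) (cup_is_linear k m).

Lemma casimir_is_linear D : linear (casimir D).
Proof.
move=> c u v; rewrite /casimir scaler_sumr -big_split /=; apply: eq_bigr => k _.
rewrite 2!scalerDr scalerA scalerA mulrC addrACA; congr (_ + _).
by rewrite scaler_sumr -big_split; apply: eq_bigr => m _; rewrite linearP.
Qed.

HB.instance Definition _ D :=
  GRing.isLinear.Build C tensor tensor _ (casimir D) (casimir_is_linear D).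

(** Sum over [b] of the invariance equations for the letters [w k] and [b] at the word [upd w k b].
    Position [k] contributes [t w] to one side and [l] copies of it to the other; the positions
    [m != k] contribute contractions and swaps respectively. *)
Lemma so_inv_position D t k w : so_inv D t -> k \in D ->
  (l%:R - 1) * t w + \sum_(m in D | m != k) t (perm_word (tperm k m) w)
  = \sum_(m in D | m != k) (w k == w m)%:R * contr k m t w.
Proof.
move=> inv kD.
have : \sum_b raise D (w k) b t (upd w k b)
     = \sum_b raise D b (w k) t (upd w k b).
  by apply: eq_bigr => b _; apply: inv.
rewrite /raise.
have pull (P : 'I_l -> pred 'I_N) (F : 'I_l -> 'I_N -> C) :
    \sum_b \sum_(j in D | P b j) F b j
    = \sum_(b | P b k) F b k
      + \sum_(j in D | j != k) \sum_(b | P b j) F b j.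
  under eq_bigr => b _ do rewrite big_mkcondr.
  by rewrite exchange_big (bigD1 k) //= -!big_mkcond; congr (_ + _);
    apply: eq_bigr => j _; rewrite -big_mkcond.
rewrite !pull.
under eq_bigl => b do rewrite upd_at.
rewrite big_pred1_eq upd_upd upd_id.
have -> : \sum_(b | upd w k b k == b) t (upd (upd w k b) k (w k)) = l%:R * t w.
  under eq_bigl => b do rewrite upd_at eqxx.
  by under eq_bigr => b _ do rewrite upd_upd upd_id;
    rewrite sumr_const card_ord mulr_natl.
move=> e.
have -> : \sum_(m in D | m != k) t (perm_word (tperm k m) w)
    = \sum_(j in D | j != k) \sum_(b | upd w k b j == b)
        t (upd (upd w k b) j (w k)).
  apply: eq_bigr => m /andP[_ mk].
  under eq_bigl => b do rewrite upd_ne // eq_sym.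
  by rewrite big_pred1_eq upd_swap // eq_sym.
have -> : \sum_(m in D | m != k) (w k == w m)%:R * contr k m t w
    = \sum_(j in D | j != k) \sum_(b | upd w k b j == w k)
        t (upd (upd w k b) j b).
  apply: eq_bigr => m /andP[_ mk].
  under [RHS]eq_bigl => b do rewrite upd_ne // eq_sym.
  rewrite ffunE; case: (w k == w m); first by rewrite mul1r.
  by rewrite mul0r big_pred0.
by move: e => /(canRL (addKr _)) ->; ring.
Qed.

Lemma casimir_so_inv D t : so_inv D t ->
  casimir D t = \sum_(k in D) \sum_(m in D | m != k) cup k m (contr k m t).
Proof.
move=> inv; apply/ffunP => w; rewrite !sum_ffunE; apply: eq_bigr => k kD.
rewrite ffunE [X in X + _]ffunE !sum_ffunE /GRing.scale /=.
under eq_bigr => m _ do rewrite perm_act_coef tpermV.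
rewrite so_inv_position //; apply: eq_bigr => m _.
by rewrite [RHS]ffunE.
Qed.

(** * Contraction of an invariant at two positions *)

Section Contraction.

Variables (D : {set 'I_N}) (k m : 'I_N).
Hypotheses (kD : k \in D) (mD : m \in D) (km : k != m).
Let D' := D :\ k :\ m.

Lemma contr_dep t : dep_on D t -> dep_on D' (contr k m t).
Proof.
move=> dep w w' e; rewrite !ffunE; apply: eq_bigr => b _; apply: dep => j jD.
rewrite !ffunE; case: eqP => // /eqP jm; case: eqP => // /eqP jk.
by apply: e; rewrite !inE jm jk.
Qed.

Lemma contr_even t : even_on D t -> even_on D' (contr k m t).
Proof.
move=> ev w; rewrite ffunE => nz a.
have [b nzb] : exists b, t (upd (upd w k b) m b) != 0.
  apply/existsP; rewrite -[[exists _, _]]negbK negb_exists.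
  by apply: contra nz => /forallP z; rewrite big1 // => b _;
    apply/eqP; have := z b; rewrite negbK.
have := ev _ nzb a.
rewrite (cardsD1 k) (cardsD1 m) !inE kD mD (eq_sym m) km upd_at updC //.
rewrite upd_at /= addnA addnn oddD odd_double /=.
congr (~~ odd _); apply: eq_card => j; rewrite !inE.
case: (j =P m) => //= jm; case: (j =P k) => //= jk.
by rewrite !upd_ne //; apply/eqP.
Qed.

Lemma raise_split t a b w :
  raise D a b t w = (if w k == a then t (upd w k b) else 0)
    + ((if w m == a then t (upd w m b) else 0) + raise D' a b t w).
Proof.
rewrite /raise !big_mkcondr /= (bigD1 k) //=; congr (_ + _).
rewrite (bigD1 m) /=; last by rewrite mD eq_sym.
congr (_ + _); apply: eq_bigl => j; rewrite !inE.
by case: (j \in D); case: (j == k); case: (j == m).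
Qed.

(** In the sum over [c] of the invariance equations at [wc c], the positions [k] and [m] contribute
    two terms that are exchanged with [a] and [b]; they cancel, and what is left is the invariance
    of the contraction. *)
Lemma contr_so_inv t : so_inv D t -> so_inv D' (contr k m t).
Proof.
move=> inv a b w.
pose wc c := upd (upd w k c) m c.
have E x y : raise D' x y (contr k m t) w = \sum_c raise D' x y t (wc c).
  rewrite /raise big_mkcondr /=.
  under [RHS]eq_bigr => c _ do rewrite big_mkcondr.
  rewrite [RHS]exchange_big; apply: eq_bigr => j.
  rewrite !inE => /and3P[jm jk _].
  under [RHS]eq_bigr => c _ do rewrite !upd_ne //.
  case: ifP => _; last by rewrite big1.
  rewrite ffunE; apply: eq_bigr => c _; congr (t _).
  by rewrite /wc updC // (updC _ _ _ jm) // (updC _ _ _ km) // updC.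
have mk : m != k by rewrite eq_sym.
have wk c : wc c k = c by rewrite upd_ne // upd_at.
have Ek x y : \sum_c (if wc c k == x then t (upd (wc c) k y) else 0)
    = t (upd (upd w k y) m x).
  under eq_bigr => c _ do rewrite wk.
  by rewrite -big_mkcond big_pred1_eq /wc (updC _ _ _ mk) upd_upd.
have Em x y : \sum_c (if wc c m == x then t (upd (wc c) m y) else 0)
    = t (upd (upd w k x) m y).
  under eq_bigr => c _ do rewrite upd_at.
  by rewrite -big_mkcond big_pred1_eq /wc upd_upd.
have ED x y : \sum_c raise D x y t (wc c)
    = t (upd (upd w k y) m x)
      + (t (upd (upd w k x) m y) + raise D' x y (contr k m t) w).
  under eq_bigr => c _ do rewrite raise_split.
  by rewrite !big_split /= Ek Em E.
have : \sum_c raise D a b t (wc c) = \sum_c raise D b a t (wc c).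
  by apply: eq_bigr => c _; apply: inv.
by rewrite !ED addrCA => /addrI/addrI.
Qed.

End Contraction.

End OrthogonalFFT.

(** * Positivity of the Casimir operator and the span of the basic invariants *)

Section CasimirPositivity.

Variables (C : numClosedFieldType) (l N : nat).

Local Notation word := {ffun 'I_N -> 'I_l}.
Local Notation tensor := (tensor C l N).
Local Notation T := (@TO C l N).

Implicit Types (D : {set 'I_N}) (t u : tensor).

(** Since $E_{ba}$ is the adjoint of $E_{ab}$, the left side is the Hermitian form of
    $\sum_{a,b}E_{ba}E_{ab}$ at [u]. A pair of positions contributes the scalar [l] to this operator
    if they coincide, and their swap otherwise. *)
Lemma raise_norm2 D u :
  \sum_(a : 'I_l) \sum_(b : 'I_l) \sum_(w : word) `|raise D a b u w| ^+ 2
  = \sum_(w : word) (casimir D u w + #|D|%:R * u w) * (u w)^*.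
Proof.
pose G (x y : word) := u x * (u y)^*.
pose S k m := \sum_(w : word) \sum_b (w k == w m)%:R * G (upd w k b) (upd w m b).
transitivity (\sum_(k in D) \sum_(m in D) S k m).
  under eq_bigr => a _ do under eq_bigr => b _ do under eq_bigr => w _ do
    rewrite normCK /raise rmorph_sum /= big_distrlr /= big_mkcondr /=.
  rewrite /S.
  under eq_bigr => a _ do rewrite exchange_big /=.
  rewrite exchange_big /=.
  under [RHS]eq_bigr => k _ do rewrite exchange_big /=.
  rewrite [RHS]exchange_big /=; apply: eq_bigr => w _.
  under [RHS]eq_bigr => k _ do rewrite exchange_big /=.
  rewrite exchange_big [RHS]exchange_big /=; apply: eq_bigr => b _.
  rewrite exchange_big /=; apply: eq_bigr => k _.
  rewrite -big_mkcond (big_pred1 (w k)) => [|a]; last by rewrite eq_sym.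
  rewrite big_mkcondr /=; apply: eq_bigr => m _.
  by rewrite eq_sym; case: eqP => _; rewrite ?mul1r ?mul0r.
have Skk k : S k k = l%:R * \sum_w G w w.
  rewrite /S pair_bigA /=.
  (* [h] exchanges the letter at [k] with the summation letter. *)
  pose h (p : word * 'I_l) := (upd p.1 k p.2, p.1 k).
  have hK : involutive h.
    by move=> [w b]; rewrite /h /= upd_upd upd_id upd_at.
  rewrite (reindex_inj (inv_inj hK)) /=.
  under eq_bigr => p _ do rewrite eqxx mul1r !upd_upd !upd_id.
  rewrite -(pair_bigA _ (fun w _ => G w w)) /=.
  under eq_bigr => w _ do rewrite sumr_const card_ord -mulr_natl.
  by rewrite mulr_sumr.
have Skm k m : m != k -> S k m = \sum_w G (perm_word (tperm k m) w) w.
  move=> mk; rewrite /S pair_bigA /=.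
  under eq_bigr => p _ do rewrite mulr_natl mulrb.
  rewrite -big_mkcond /=.
  (* A word with equal letters at [k] and [m], together with a letter [b], amounts to an arbitrary
     word: [b] is put at [m]. *)
  pose h (w : word) := (upd w m (w k), w m).
  rewrite (reindex_onto h (fun p => upd p.1 m p.2)) => [|[w b] /= /eqP e].
    rewrite /h; apply: eq_big => w /=; first by rewrite upd_at upd_upd upd_id
      upd_ne ?eqxx // eq_sym.
    by rewrite upd_upd upd_id upd_swap // tpermC.
  by rewrite /h upd_upd upd_at upd_ne 1?eq_sym // e upd_id.
transitivity (\sum_(k in D) (l%:R * \sum_w G w w
    + \sum_(m in D | m != k) \sum_w G (perm_word (tperm k m) w) w)).
  apply: eq_bigr => k kD; rewrite (bigD1 k) //= Skk; congr (_ + _).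
  by apply: eq_bigr => m /andP[_ mk]; rewrite Skm.
have cE w : casimir D u w + #|D|%:R * u w
    = \sum_(k in D) (l%:R * u w
        + \sum_(m in D | m != k) u (perm_word (tperm k m) w)).
  rewrite mulr_natl -sumr_const sum_ffunE -big_split /=.
  apply: eq_bigr => k kD; rewrite ffunE [X in X + _ + _]ffunE sum_ffunE /GRing.scale /=.
  under eq_bigr => m _ do rewrite perm_act_coef tpermV.
  ring.
under [RHS]eq_bigr => w _ do rewrite cE mulr_suml.
rewrite exchange_big /=; apply: eq_bigr => k _.
rewrite mulr_sumr exchange_big -big_split /=; apply: eq_bigr => w _.
by rewrite mulrDl mulr_suml mulrA.
Qed.

(** The terms with [a = b] alone give $\sum_a n_a^2|u(w)|^2$, where $n_a$ is the number of letters
    [a] on [D]. The $n_a$ being even, $\sum_a n_a^2\ge 2\sum_a n_a = 2|D|$, whereas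
    [casimir D u = 0] makes the whole sum equal to $|D|$ times the squared norm of [u]. *)
Lemma casimir_inj D u : D != set0 -> even_on D u -> casimir D u = 0 -> u = 0.
Proof.
move=> D0 ev cu; have := raise_norm2 D u; rewrite cu.
under [X in _ = X -> _]eq_bigr => w _ do rewrite ffunE add0r -mulrA -normCK.
move=> e.
have low : \sum_(w : word) #|D|%:R * `|u w| ^+ 2 *+ 2
    <= \sum_(a : 'I_l) \sum_(b : 'I_l) \sum_(w : word) `|raise D a b u w| ^+ 2.
  apply: (@le_trans _ _
    (\sum_(a : 'I_l) \sum_(w : word) `|raise D a a u w| ^+ 2)).
    rewrite exchange_big; apply: ler_sum => w _ /=.
    have cD : #|D| = (\sum_(a : 'I_l) #|[set k in D | w k == a]|)%N.
      rewrite -sum1_card (partition_big w predT) //=; apply: eq_bigr => a _.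
      by rewrite -sum1_card; apply: eq_bigl => k; rewrite inE.
    rewrite cD natr_sum mulr_suml -sumrMnl; apply: ler_sum => a _.
    have -> : raise D a a u w = #|[set k in D | w k == a]|%:R * u w.
      rewrite mulr_natl -sumr_const /raise; apply: eq_big => k.
        by rewrite inE.
      by case/andP=> _ /eqP <-; rewrite upd_id.
    rewrite normrM exprMn normr_nat -mulrnAl -mulrnA.
    have [->|nz] := eqVneq (u w) 0; first by rewrite normr0 expr0n !mulr0.
    apply: ler_wpM2r; first exact: exprn_ge0.
    rewrite -natrX ler_nat.
    have := ev w nz a; case: #|_| => [|[|n]] //= _.
    by rewrite leq_mul2l.
  apply: ler_sum => a _; rewrite [leRHS](bigD1 a) //= lerDl.
  by apply: sumr_ge0 => b _; apply: sumr_ge0 => w _; apply: exprn_ge0.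
rewrite e sumrMnl mulr2n gerDl -mulr_sumr pmulr_rle0 in low; last first.
  by rewrite ltr0n card_gt0.
apply/ffunP => w; rewrite ffunE; apply/eqP; rewrite -normr_eq0 -sqrf_eq0.
have /eqP : \sum_(w : word) `|u w| ^+ 2 = 0.
  by apply/le_anti; rewrite low sumr_ge0 // => v _; apply: exprn_ge0.
rewrite psumr_eq0 => [/allP/(_ w)|v _]; last exact: exprn_ge0.
by rewrite mem_index_enum; apply.
Qed.

Lemma involution_card_even (I : finType) (s : {perm I}) (A : {set I}) :
  (forall k, k \in A -> [/\ s k \in A, s (s k) = k & s k != k]) ->
  ~~ odd #|A|.
Proof.
elim: {A}#|A| {-2}A (leqnn #|A|) => [|n IH] A.
  by rewrite leqn0 => /eqP ->.
move=> cA sA; have [->|[k kA]] := set_0Vmem A; first by rewrite cards0.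
have [skA ssk sk] := sA _ kA.
have ckA : #|A| = #|A :\ k :\ s k|.+2.
  by rewrite (cardsD1 k) kA (cardsD1 (s k)) !inE sk skA.
rewrite ckA /= negbK; apply: IH => [|j].
  by rewrite -ltnS -ltnS -ckA; apply: leq_trans cA _.
rewrite !inE => /and3P[j1 j2 /sA [sjA ssj sj]]; split=> //.
rewrite sjA andbT (inj_eq perm_inj) j2 /=.
by apply: contra j1 => /eqP <-; rewrite ssj.
Qed.

Lemma matchingP D (s : 'S_N) : reflect
  (forall k, s (s k) = k /\ (s k != k) = (k \in D)) (matching D s).
Proof.
by apply: (iffP forallP) => h k; [case/andP: (h k) => /eqP -> /eqP -> | case: (h k) => -> ->];
  rewrite ?eqxx.
Qed.

Lemma TO_even D (s : 'S_N) : matching D s -> even_on D (T s).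
Proof.
move=> /matchingP mD w; rewrite TO_coef.
case: (perm_word s w =P w) => [e _ a|_]; last by rewrite eqxx.
apply: (@involution_card_even _ s) => k; rewrite !inE => /andP[kD wk].
have [ssk skk] := mD k; have [sssk] := mD (s k).
by rewrite !ssk eq_sym skk kD => <-; rewrite -(eqP wk) -{2}e ffunE eqxx.
Qed.

Definition TO_span D := <<[seq T s | s <- enum 'S_N & matching D s]>>%VS.

Lemma mem_TO_span D s : matching D s -> T s \in TO_span D.
Proof. by move=> m; apply/memv_span/map_f; rewrite mem_filter m mem_enum. Qed.

Lemma even_on_span D t : t \in TO_span D -> even_on D t.
Proof.
move=> tD w nz a; apply: contraNN nz => odd_a.
suff : coef w t \in 0%VS by rewrite memv0.
apply: linear_span_sub tD => x /mapP[s].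
rewrite mem_filter memv0 => /andP[ms _ ->].
by apply: contraTT odd_a => nz; apply: (TO_even ms).
Qed.

Lemma casimir_TO_span D t : t \in TO_span D -> casimir D t \in TO_span D.
Proof.
apply: linear_span_sub => x /mapP[s].
rewrite mem_filter => /andP[ms _ ->].
rewrite /casimir; apply: memv_suml => k kD; apply: memvD.
  exact/memvZ/mem_TO_span.
apply: memv_suml => m /andP[mD mk]; rewrite perm_act_TO; apply: mem_TO_span.
apply/matchingP => j; move/matchingP: ms => ms; rewrite !permM !permKV.
set i := tperm k m j; have [-> e] := ms i; rewrite tpermV tpermK; split=> //.
rewrite (can2_eq (tpermK _ _) (tpermK _ _)) -/i e /i.
by case: tpermP => // ->; rewrite ?kD ?mD.
Qed.

(** Being injective on the span, [casimir D] maps it onto itself, so some [u] in the span has the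
    same image as [t]; the difference [t - u] is even on [D], hence zero. *)
Lemma so_inv_in_TO_span D t :
  dep_on D t -> so_inv D t -> even_on D t -> t \in TO_span D.
Proof.
elim: {D}_.+1 {-2}D (ltnSn #|D|) t => // n IH D cD t dep inv ev.
have [D0|D0] := eqVneq D set0.
  have [w0 _|none] := pickP (@predT word); last first.
    by rewrite (_ : t = 0) ?mem0v //; apply/ffunP => w; have := none w.
  have -> : t = (t w0 : C) *: T 1%g.
    apply/ffunP => w; rewrite ffunE TO_coef perm_word1 eqxx /GRing.scale /= mulr1.
    by apply: dep => k; rewrite D0 inE.
  apply/memvZ/mem_TO_span/matchingP => k.
  by rewrite !perm1 eqxx D0 inE.
have ct : casimir D t \in TO_span D.
  rewrite casimir_so_inv //; apply: memv_suml => k kD.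
  apply: memv_suml => m /andP[mD mk]; have km : k != m by rewrite eq_sym.
  apply: (@linear_span_sub _ _ _ (cup k m)
    [seq T s | s <- enum 'S_N & matching (D :\ k :\ m) s]); last first.
    apply: IH; [|exact: contr_dep|exact: contr_so_inv|exact: contr_even].
    apply: leq_trans (_ : #|D| <= n)%N; last by rewrite -ltnS.
    by rewrite [leqRHS](cardsD1 k) kD ltnS subset_leq_card // subsetDl.
  move=> x /mapP[s]; rewrite mem_filter => /andP[/matchingP ms _ ->].
  have [sk sm] : s k = k /\ s m = m.
    split; apply/eqP; rewrite -[_ == _]negbK; [have [_ ->] := ms k|have [_ ->] := ms m];
    by rewrite !inE eqxx ?andbF.
  (* Both [k] and [m] are fixed by [s], and the cup adds them to the matching as a new pair. *)
  have cupT : cup k m (T s) = T (s * tperm k m)%g.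
    apply/ffunP => w; rewrite [LHS]ffunE !TO_coef -natrM mulnb; congr (_%:R).
    congr nat_of_bool; apply/andP/eqP => [[/eqP wkm /eqP e]|e].
      apply/ffunP => j; rewrite -{2}e !ffunE permM.
      by case: tpermP => // ->; rewrite ?sk ?sm.
    have wkm : w k = w m by rewrite -{1}e ffunE permM sk tpermL.
    rewrite wkm eqxx; split=> //; apply/eqP/ffunP => j; rewrite -{2}e !ffunE permM.
    by case: tpermP => // ->.
  rewrite [X in X \in _]cupT; apply/mem_TO_span/matchingP => j; rewrite !permM.
  have [ssj sj] := ms j; rewrite !inE in sj.
  have [->|jk] := eqVneq j k.
    by rewrite sk tpermL sm tpermR mk.
  have [->|jm] := eqVneq j m.
    by rewrite sm tpermR sk tpermL km.
  have [ks ms'] : k != s j /\ m != s j.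
    by rewrite -{1}sk -{1}sm !(inj_eq perm_inj) !(eq_sym _ j).
  by rewrite !(tpermD ks ms') ssj sj jk jm tpermD 1?eq_sym.
have [u uD eu] : exists2 u, u \in TO_span D & casimir D u = casimir D t.
  apply: (@linear_stable_inj _ _ (casimir D)) => // [v|v vD].
    exact: casimir_TO_span.
  exact/casimir_inj/even_on_span.
suff -> : t = u by [].
apply/eqP; rewrite -subr_eq0; apply/eqP/(@casimir_inj D) => //.
  move=> w; rewrite !ffunE => nz a; have [z|/ev/(_ a)//] := eqVneq (t w) 0.
  by rewrite z add0r oppr_eq0 in nz; apply: even_on_span nz a.
by rewrite linearB /= eu subrr.
Qed.

End CasimirPositivity.

(** * Consequences of invariance under reflections *)

Lemma coef0_bigprod (K : comNzRingType) (I : Type) (r : seq I) (P : pred I)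
    (p : I -> {poly K}) :
  (\prod_(i <- r | P i) p i)`_0 = \prod_(i <- r | P i) (p i)`_0.
Proof.
by apply: (big_morph (fun q : {poly K} => q`_0)) => [x y|];
  rewrite ?coef0M ?coef1.
Qed.

(** The Leibniz rule, read at 0. *)
Lemma coef1_bigprod (K : comNzRingType) (I : finType) (p : I -> {poly K}) :
  (\prod_i p i)`_1 = \sum_i (p i)`_1 * \prod_(j | j != i) (p j)`_0.
Proof.
have cM (q r : {poly K}) : (q * r)`_1 = q`_1 * r`_0 + q`_0 * r`_1.
  by rewrite coefM !big_ord_recl big_ord0 addr0 addrC.
suff H (s : seq I) : uniq s -> (\prod_(i <- s) p i)`_1
    = \sum_(i <- s) (p i)`_1 * \prod_(j <- s | j != i) (p j)`_0.
  by rewrite H ?index_enum_uniq.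
elim: s => [|x s IH] /=; first by rewrite !big_nil coef1.
case/andP=> xs us; rewrite !big_cons cM coef0_bigprod IH // eqxx /=.
congr (_ * _ + _).
  apply/esym; rewrite big_seq_cond [RHS]big_seq; apply: eq_bigl => i.
  by case: (i \in s) / idP => //= si; apply: contraNneq xs => <-.
rewrite mulr_sumr big_seq [RHS]big_seq; apply: eq_bigr => i si.
rewrite big_cons; case: eqP => [e|_]; first by rewrite e si in xs.
by rewrite mulrCA.
Qed.

Lemma nat_roots_poly0 (K : numDomainType) (p : {poly K}) :
  (forall n : nat, p.[n%:R] = 0) -> p = 0.
Proof.
move=> p0; apply/eqP/negPn/negP => nz.
pose s := [seq (i%:R : K) | i <- iota 0 (size p)].
suff : (size s < size p)%N by rewrite size_map size_iota ltnn.
apply: max_poly_roots => //; first by apply/allP => _ /mapP[i _ ->]; apply/eqP.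
by rewrite map_inj_uniq ?iota_uniq // => i j /eqP; rewrite eqr_nat => /eqP.
Qed.

Section OrthogonalInvariants.

Variables (R : realType) (l N : nat).

Local Notation C := (R[i]).
Local Notation FO := (@FO R l N).
Local Notation word := {ffun 'I_N -> 'I_l}.
Local Notation T := (@TO C l N).

Definition reflection (v : 'cV[R]_l) : 'M[R]_l :=
  1%:M - (2 / (v^T *m v) 0 0) *: (v *m v^T).

Lemma reflection_orthogonal v : (v^T *m v) 0 0 != 0 ->
  reflection v *m (reflection v)^T = 1%:M.
Proof.
set n := (v^T *m v) 0 0 => n0.
have XX : v *m v^T *m (v *m v^T) = n *: (v *m v^T).
  rewrite mulmxA -(mulmxA v) (_ : v^T *m v = n%:M).
    by rewrite mul_mx_scalar -scalemxAl.
  by apply/matrixP => i j; rewrite !ord1 [RHS]mxE mulr1n.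
have Xt : (v *m v^T)^T = v *m v^T by rewrite trmx_mul trmxK.
rewrite /reflection -/n; move: (v *m v^T) XX Xt => X XX Xt.
have -> : (1%:M - (2 / n) *: X)^T = 1%:M - (2 / n) *: X.
  by rewrite -{2}Xt; apply/matrixP => i j; rewrite !mxE eq_sym.
rewrite mulmxBl mul1mx mulmxBr mulmx1 -scalemxAl -scalemxAr XX.
by apply/matrixP => i j; rewrite !mxE; field.
Qed.

(** With one end of each pair collected in [A], the coefficient factors over the pairs, and each
    factor is an entry of $UU^T$. *)
Lemma mx_act_TO (K : fieldType) (U : 'M[K]_l) s :
  U *m U^T = 1%:M -> matching [set: 'I_N] s ->
  mx_act U (@TO K l N s) = @TO K l N s.
Proof.
move=> UU /matchingP ms; apply/ffunP => w; rewrite mx_act_coef TO_coef.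
have sK k : s (s k) = k by have [] := ms k.
(* The letter [w k0] serves below as a default value; without positions there is only one word. *)
have [k0 _|none] := pickP (@predT 'I_N); last first.
  have ww (v : word) : v = w by apply/ffunP => k; have := none k.
  rewrite (big_pred1 w) => [|v]; last by rewrite /= (ww v) eqxx.
  by rewrite TO_coef (ww (perm_word s w)) eqxx big_pred0 ?mulr1.
pose A := [set k : 'I_N | (k < s k)%N].
have sA k : (s k \in A) = (k \notin A).
  rewrite !inE sK ltn_neqAle -leqNgt; case: eqP => // /val_inj e.
  by have [_] := ms k; rewrite e eqxx inE.
have prodA (F : 'I_N -> K) : \prod_k F k = \prod_(k in A) (F k * F (s k)).
  rewrite (bigID (mem A)) big_split /=; congr (_ * _).
  by rewrite [RHS](reindex_inj (@perm_inj _ s)); apply: eq_big => k;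
    rewrite ?sA ?sK.
transitivity (\prod_(k in A) \sum_c U (w k) c * U (w (s k)) c); last first.
  transitivity (\prod_(k in A) (w k == w (s k))%:R : K).
    apply: eq_bigr => k _; have /matrixP/(_ (w k) (w (s k))) := UU.
    by rewrite !mxE => <-; apply: eq_bigr => c _; rewrite mxE.
  have [e|ne] := eqVneq (perm_word s w) w.
    by rewrite big1 // => k _; rewrite -{1}e ffunE eqxx.
  have [k wk] : exists k, w k != w (s k).
    apply/existsP; rewrite -negb_forall; apply: contra ne => /forallP e.
    by apply/eqP/ffunP => k; rewrite ffunE; apply/esym/eqP.
  have [kA|kA] := boolP (k \in A); first by rewrite (bigD1 k) //= (negbTE wk) mul0r.
  by rewrite (bigD1 (s k)) ?sA //= sK eq_sym (negbTE wk) mul0r.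
rewrite (big_distr_big_dep (w k0)) /=.
under eq_bigr => v _ do rewrite TO_coef mulr_natl mulrb.
rewrite -big_mkcond /=.
(* [h] and [h'] identify the [s]-invariant words with the functions on [A], continued by the default
   letter [w k0]. *)
pose h (f : word) : word := [ffun k => if k \in A then f k else f (s k)].
pose h' (v : word) : word := [ffun k => if k \in A then v k else w k0].
rewrite (reindex_onto h h') /=; last first.
  move=> v /eqP e; apply/ffunP => k; rewrite !ffunE sA.
  by case: (k \in A) => //=; rewrite -{2}e ffunE.
apply: eq_big => f.
  have -> : perm_word s (h f) == h f.
    apply/eqP/ffunP => k; rewrite !ffunE sA sK.
    by case: (k \in A).
  apply/eqP/pfamilyP => [e|[/supportP f0 _]].
    split=> //; apply/supportP => k kA.
    by rewrite -e !ffunE (negbTE kA).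
  apply/ffunP => k; rewrite !ffunE.
  have [//|kA] := boolP (k \in A).
  exact/esym/f0.
move=> _; rewrite prodA; apply: eq_bigr => k kA.
by rewrite !ffunE sA kA /= sK.
Qed.

Lemma FO_TO s : matching [set: 'I_N] s -> FO (T s).
Proof.
move=> ms U UU; apply: mx_act_TO => //.
by rewrite map_trmx -map_mxM UU map_mx1.
Qed.

(** The reflection in $e_a$ multiplies the coefficient at [w] by -1 to the number of letters [a] in
    [w]. *)
Lemma FO_even t : FO t -> even_on [set: 'I_N] t.
Proof.
move=> inv w nz a; pose v := delta_mx a 0 : 'cV[R]_l.
have vv : (v^T *m v) 0 0 = 1.
  by rewrite trmx_delta mul_delta_mx mxE.
have reflE c d :
    reflection v c d = (c == d)%:R - 2 * ((c == a) && (d == a))%:R.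
  by rewrite /reflection vv divr1 /v trmx_delta mul_delta_mx !mxE.
have := inv _ (@reflection_orthogonal v _); rewrite vv oner_eq0 => /(_ isT).
move/ffunP/(_ w); rewrite mx_act_coef (bigD1 w) //= [X in _ + X]big1 => [|w' ne]; last first.
  have [k wk] : exists k, w k != w' k.
    apply/existsP; rewrite -negb_forall; apply: contra ne => /forallP e.
    by apply/eqP/ffunP => k; apply/esym/eqP.
  rewrite (bigD1 k) //= [X in _ * (X * _)]mxE reflE (negbTE wk).
  case: (w k =P a) wk => [->|_ _] /=; last by rewrite mulr0 subr0 rmorph0 mul0r mulr0.
  by rewrite eq_sym => /negbTE ->; rewrite mulr0 subr0 rmorph0 mul0r mulr0.
rewrite addr0 => e.
have {}e : t w * (-1) ^+ #|[set k in [set: 'I_N] | w k == a]| = t w.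
  rewrite -[RHS]e; congr (_ * _).
  rewrite -prodr_const big_mkcond; apply: eq_bigr => k _.
  rewrite !inE [RHS]mxE reflE eqxx andbb; case: eqP => _ /=.
    by rewrite mulr1 (_ : 1 - 2 = -1) ?rmorphN1 //; ring.
  by rewrite mulr0 subr0 rmorph1.
apply/negP => o; move: e; rewrite -signr_odd o mulrN1 => /eqP.
by rewrite eq_sym -addr_eq0 -mulr2n mulrn_eq0 (negbTE nz).
Qed.

(* The reflections in e_a + x e_b, with denominators cleared, are polynomial in
   x; the coefficient of x in the invariance equation is the claim. *)
Lemma FO_so_inv t : FO t -> so_inv [set: 'I_N] t.
Proof.
move=> inv a b w; have [->//|ab] := eqVneq a b.
have abF : (a == b) = false by apply/negbTE.
have baF : (b == a) = false by rewrite eq_sym.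
(* [v] is $e_a + Xe_b$, [q] is the matrix of its reflection times $1 + X^2$, and [F] is the
   invariance equation at [w] times $(1 + X^2)^N$. *)
pose v (c : 'I_l) : {poly C} := (c == a)%:R%:P + (c == b)%:R *: 'X.
pose q c d : {poly C} := (c == d)%:R *: (1 + 'X^2) - (v c * v d) *+ 2.
pose F := \sum_(w' : word) (t w' : C) *: \prod_k q (w k) (w' k)
   - (t w : C) *: \prod_(k : 'I_N) (1 + 'X^2).
have F0 : F = 0.
  (* At a natural number the vector is real, so that invariance under the real orthogonal group
     applies. *)
  apply: nat_roots_poly0 => n.
  pose u : 'cV[R]_l := \col_c ((c == a)%:R + (c == b)%:R * n%:R).
  have uu : (u^T *m u) 0 0 = 1 + n%:R ^+ 2.
    rewrite mxE (bigD1 a) //= (bigD1 b) 1?eq_sym //= big1 => [|c /andP[ca cb]].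
      by rewrite !mxE !eqxx abF baF /=; ring.
    by rewrite !mxE (negbTE ca) (negbTE cb) /=; ring.
  have n0 : (1 + n%:R ^+ 2 : R) != 0.
    by rewrite gt_eqF // ltr_pwDl // ?exprn_ge0.
  have := inv _ (@reflection_orthogonal u _); rewrite uu => /(_ n0).
  move/ffunP/(_ w); rewrite mx_act_coef => e.
  rewrite /F hornerD hornerN horner_sum hornerZ horner_prod -[t w]e mulr_suml -sumrB.
  apply: big1 => w' _; rewrite hornerZ horner_prod -mulrA -big_split /=.
  apply/eqP; rewrite subr_eq0; apply/eqP; congr (_ * _); apply: eq_bigr => k _.
  have -> : (1 + 'X^2).[n%:R] = real_complex R (1 + n%:R ^+ 2).
    by rewrite !hornerE rmorphD rmorph1 rmorphXn rmorph_nat.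
  rewrite [X in _ = X * _]mxE -rmorphM /reflection uu !mxE big_ord1 !mxE.
  set x := w k; set y := w' k.
  transitivity (real_complex R ((x == y)%:R * (1 + n%:R ^+ 2)
     - ((x == a)%:R + (x == b)%:R * n%:R)
         * ((y == a)%:R + (y == b)%:R * n%:R) *+ 2)).
    rewrite /q /v !hornerE !(rmorphB, rmorphD, rmorphM, rmorphMn, rmorph1, rmorphXn, rmorph_nat) /=.
    by rewrite expr2.
  by congr (real_complex R _); field.
have vE c : (v c)`_0 = (c == a)%:R /\ (v c)`_1 = (c == b)%:R.
  by rewrite /v !coefD !coefZ !coefX !coefC /= mulr0 mulr1 addr0 add0r.
(* At $X = 0$ the reflection is diagonal, with entry -1 at [a] and 1 elsewhere. *)
pose eps (c : 'I_l) : C := (-1) ^+ (c == a).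
have q0 c d : (q c d)`_0 = (c == d)%:R * eps c.
  rewrite /q coefB coefZ coefMn coef0M coefD coef1 coefXn /= addr0 mulr1.
  have [[-> _] [-> _]] := (vE c, vE d); rewrite /eps.
  case: (c =P d) => [->|cd]; first by case: eqP => _ /=; rewrite ?expr1 ?expr0; ring.
  case: (c =P a) => [ca|_]; case: (d =P a) => [da|_]; rewrite ?mul0r ?mulr0 ?mul0rn ?subr0 //.
  by case: cd; rewrite ca da.
have q1 c d : (q c d)`_1 = - ((c == a)%:R * (d == b)%:R + (c == b)%:R * (d == a)%:R) *+ 2.
  rewrite /q coefB coefZ coefMn coefM !big_ord_recl big_ord0 coefD coef1 coefXn /=.
  have [[-> ->] [-> ->]] := (vE c, vE d).
  by ring.
have := congr1 (fun p : {poly C} => p`_1) F0.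
rewrite /F coefB coef_sum coef0 coefZ coef1_bigprod [X in _ - _ * X]big1 => [|k _]; last first.
  by rewrite coefD coef1 coefXn addr0 mul0r.
rewrite mulr0 subr0.
under eq_bigr => w' _ do rewrite coefZ coef1_bigprod mulr_sumr.
rewrite exchange_big /=.
pose E := \prod_j eps (w j).
have epsK c : eps c * eps c = 1 by rewrite /eps; case: eqP => _; rewrite ?expr1 ?expr0; ring.
have E0 : E != 0.
  by apply/prodf_neq0 => j _; rewrite signr_eq0.
have pick k x : \sum_c (c == x)%:R * t (upd w k c) = t (upd w k x).
  rewrite (bigD1 x) //= eqxx mul1r big1 ?addr0 // => c /negbTE ->.
  by rewrite mul0r.
have inner k : \sum_(w' : word) t w' *
      ((q (w k) (w' k))`_1 * \prod_(j | j != k) (q (w j) (w' j))`_0)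
    = E * 2 * ((if w k == a then t (upd w k b) else 0)
               - (if w k == b then t (upd w k a) else 0)).
  (* The constant terms at the positions other than [k] force [w'] to agree with [w] there, so only
     the words [upd w k c] survive. *)
  rewrite (bigID (fun w' : word => upd w k (w' k) == w')) /=.
  rewrite [X in _ + X]big1 ?addr0 => [|w' ne]; last first.
    have [j] : exists j, upd w k (w' k) j != w' j.
      apply/existsP; rewrite -negb_forall; apply: contra ne => /forallP e.
      by apply/eqP/ffunP => j; apply/eqP.
    have [->|jk] := eqVneq j k; first by rewrite upd_at eqxx.
    rewrite upd_ne // => wj.
    by rewrite (bigD1 j) //= q0 (negbTE wj) !(mul0r, mulr0).
  rewrite (reindex_onto (upd w k) (fun w' : word => w' k)) /= => [|w' /eqP //].
  under eq_bigl => c do rewrite !upd_at !eqxx.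
  transitivity (\sum_c (- 2 * (eps (w k) * E) * (w k == a)%:R
        * ((c == b)%:R * t (upd w k c))
      - 2 * (eps (w k) * E) * (w k == b)%:R
        * ((c == a)%:R * t (upd w k c)))).
    apply: eq_bigr => c _; rewrite upd_at q1.
    have -> : \prod_(j | j != k) (q (w j) (upd w k c j))`_0 = eps (w k) * E.
      rewrite /E [X in _ * X](bigD1 k) //= mulrA epsK mul1r; apply: eq_bigr => j jk.
      by rewrite upd_ne // q0 eqxx mul1r.
    by ring.
  rewrite sumrB -!mulr_sumr !pick /eps.
  case: (w k =P a) => [->|wa]; first by rewrite (negbTE ab) /=; ring.
  by case: (w k =P b) => _ /=; ring.
under eq_bigr => k _ do rewrite inner.
rewrite -mulr_sumr sumrB -!big_mkcond => /eqP.
rewrite !mulf_eq0 (negbTE E0) pnatr_eq0 /= subr_eq0 => /eqP e.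
by rewrite /raise; under eq_bigl do rewrite inE; rewrite e;
  apply: eq_bigl => k; rewrite inE.
Qed.

Lemma FO_TO_span t : FO t -> t \in TO_span C l [set: 'I_N].
Proof.
move=> inv; apply: so_inv_in_TO_span; last 2 first.
- exact: FO_so_inv.
- exact: FO_even.
by move=> w w' e; congr (t _); apply/ffunP => k; apply: e; rewrite inE.
Qed.

End OrthogonalInvariants.
(** * The Young subgroup and [Pi] *)

Section YoungSubgroup.

Variables (N : nat) (X : eqType) (b : 'I_N -> X).

Implicit Types (s t : 'S_N) (P Q : pred X).

(** The labels are arbitrary because several labellings occur: block indices, pairs of block
    indices, and blocks refined by a colour. *)
Definition young s := [forall k, b (s k) == b k].

Lemma youngP s : reflect (forall k, b (s k) = b k) (young s).
Proof. by apply: (iffP forallP) => h k; apply/eqP. Qed.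

Lemma young1 : young 1%g.
Proof. by apply/youngP => k; rewrite perm1. Qed.

Lemma youngM s t : young s -> young t -> young (s * t)%g.
Proof. by move=> /youngP ys /youngP yt; apply/youngP => k; rewrite permM yt ys. Qed.

Lemma youngV s : young s -> young s^-1%g.
Proof. by move=> /youngP ys; apply/youngP => k; rewrite -{2}(permKV s k) ys. Qed.

Lemma young_tperm k m : b k = b m -> young (tperm k m).
Proof. by move=> e; apply/youngP => j; case: tpermP => // ->. Qed.

Definition union_of P : {set 'I_N} := [set k | P (b k)].

Definition restr_young P s : 'S_N := restr_perm (union_of P) s.

Lemma restr_youngE P s k : young s ->
  restr_young P s k = if P (b k) then s k else k.
Proof.
move=> /youngP ys; case: ifPn => Pk; last first.
  by apply: (out_perm (restr_perm_on _ _)); rewrite inE.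
apply: restr_permE; last by rewrite inE.
by apply/astabsP => j; rewrite !inE /= apermE ys.
Qed.

Lemma restr_youngM P s t : young s -> young t ->
  restr_young P (s * t)%g = (restr_young P s * restr_young P t)%g.
Proof.
move=> ys yt; apply/permP => k.
rewrite permM !restr_youngE ?youngM // permM.
by case: ifP => Pk; rewrite ?(youngP _ ys) Pk.
Qed.

Definition young_on P s := young s && perm_on (union_of P) s.

Lemma eq_young_on P Q : P =1 Q -> young_on P =1 young_on Q.
Proof.
move=> PQ s; rewrite /young_on (_ : union_of P = union_of Q) //.
by apply/setP => k; rewrite !inE PQ.
Qed.

Lemma young_onP P s : reflect
  ((forall k, b (s k) = b k) /\ forall k, ~~ P (b k) -> s k = k) (young_on P s).
Proof.
apply: (iffP andP) => [[/youngP ys on]|[ys fix_s]].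
  by split=> // k Pk; apply: (out_perm on); rewrite inE.
split; first exact/youngP.
by apply/subsetP => k; rewrite !inE; apply: contraR => /fix_s ->.
Qed.

Lemma restr_young_on P s : young s -> young_on P (restr_young P s).
Proof.
move=> ys; apply/young_onP; split=> k; last by rewrite restr_youngE // => /negbTE ->.
by rewrite restr_youngE //; case: ifP => // _; apply/youngP.
Qed.

Lemma restr_young_split P Q s : (forall x, P x -> ~~ Q x) ->
  young_on (predU P Q) s -> s = (restr_young P s * restr_young Q s)%g.
Proof.
move=> PQ sPQ; have /young_onP[sy sfix] := sPQ; have /andP[ys _] := sPQ.
apply/permP => k; rewrite permM !restr_youngE //.
have [Pk|Pk] := boolP (P (b k)); first by rewrite sy (negbTE (PQ _ Pk)).
by case: ifPn => // Qk; rewrite sfix //= negb_or Pk.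
Qed.

Variable C : fieldType.

Local Notation galg := (galg C N).
Local Notation gelt := (@gelt C N).
Local Notation gmul := (@gmul C N).

Lemma gmul_sums (A B : pred 'S_N) (c d : 'S_N -> C) :
  gmul (\sum_(s | A s) c s *: gelt s) (\sum_(t | B t) d t *: gelt t)
  = \sum_(s | A s) \sum_(t | B t) (c s * d t) *: gelt (s * t)%g.
Proof.
have coefE (D : pred 'S_N) (f : 'S_N -> C) s :
    (\sum_(t | D t) f t *: gelt t) s = if D s then f s else 0.
  rewrite sum_ffunE; case: ifP => Ds; last first.
    apply: big1 => t Dt; rewrite 2!ffunE; case: eqP => [e|]; last by rewrite scaler0.
    by rewrite e Dt in Ds.
  rewrite (bigD1 s) //= big1 => [|t /andP[_ /negbTE ts]]; rewrite 2!ffunE.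
    by rewrite eqxx addr0 /GRing.scale /= mulr1.
  by rewrite eq_sym ts scaler0.
rewrite /Defs.gmul [RHS]big_mkcond; apply: eq_bigr => s _.
rewrite coefE; case: ifP => _; last first.
  by apply: big1 => t _; rewrite mul0r scale0r.
rewrite [RHS]big_mkcond; apply: eq_bigr => t _.
by rewrite coefE; case: ifP => // _; rewrite mulr0 scale0r.
Qed.

(** For disjoint [P] and [Q], multiplication of permutations is a bijection onto the Young subgroup
    of the union, with the pair of restrictions as its inverse. *)
Lemma gmul_young P Q (c d : 'S_N -> C) : (forall x, P x -> ~~ Q x) ->
  gmul (\sum_(s | young_on P s) c s *: gelt s)
       (\sum_(t | young_on Q t) d t *: gelt t)
  = \sum_(s | young_on (predU P Q) s)
      (c (restr_young P s) * d (restr_young Q s)) *: gelt s.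
Proof.
move=> PQ; rewrite gmul_sums pair_big /=.
pose h s := (restr_young P s, restr_young Q s).
have hK p : young_on P p.1 && young_on Q p.2 -> h (p.1 * p.2)%g = p.
  case: p => s t /= /andP[/young_onP[ys fs] /young_onP[yt ft]].
  have yst : young (s * t)%g by apply: youngM; apply/youngP.
  congr pair; apply/permP => k; rewrite restr_youngE // permM.
    by case: ifPn => Pk; [rewrite ft // ys PQ | rewrite fs].
  case: ifPn => Qk; last by rewrite ft.
  by rewrite fs //; apply: contraL Qk => /PQ.
rewrite (reindex_onto h (fun p => (p.1 * p.2)%g)) //=.
apply: eq_big => s; last by case/andP=> _ /eqP ->.
apply/andP/idP => [[/andP[sP sQ] /eqP <-]|sPQ].
  apply/young_onP; move/young_onP: sP => [y1 f1]; move/young_onP: sQ => [y2 f2].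
  split=> k; rewrite permM; first by rewrite y2 y1.
  by rewrite /= negb_or => /andP[Pk Qk]; rewrite f1 // f2.
have /andP[ys _] := sPQ.
by rewrite !restr_young_on // eq_sym; split=> //; apply/eqP/restr_young_split.
Qed.

(** The flag [e] selects between signed and unsigned sums, which treats the factors [Esym] and
    [Hsym] at once. *)
Lemma gmul_young_big (r : seq X) P (e : bool) : uniq r ->
  \big[gmul/gelt 1%g]_(i <- r | P i)
     (\sum_(s | young_on (pred1 i) s) (-1) ^+ (e && s) *: gelt s)
  = \sum_(s | young_on [pred i in r | P i] s) (-1) ^+ (e && s) *: gelt s.
Proof.
elim: r => [_|i r IH /= /andP[ir ur]].
  rewrite big_nil (big_pred1 1%g) => [|s]; first by rewrite odd_perm1 andbF scale1r.
  apply/young_onP/eqP => [[_ f]|->]; last by split=> k; rewrite perm1.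
  by apply/permP => k; rewrite perm1 f.
rewrite big_cons; case: ifP => Pi; last first.
  rewrite IH //; apply: eq_bigl => s; apply: eq_young_on => j.
  by rewrite /= inE; case: eqP => [->|] //=; rewrite Pi andbF.
rewrite IH // gmul_young => [|x /eqP -> /=]; last by rewrite (negbTE ir).
have E s : young_on (predU (pred1 i) [pred j in r | P j]) s
    = young_on [pred j in i :: r | P j] s.
  by apply: eq_young_on => j; rewrite /= inE; case: eqP => [->|] //=; rewrite Pi.
apply: eq_big => // s sE; congr (_ *: _).
rewrite -signr_addb -andb_addr -odd_permM -restr_young_split //.
by move=> x /eqP ->; rewrite /= (negbTE ir).
Qed.

End YoungSubgroup.

(** * [Pi] as the sum of a character over the Young subgroup *)

Section PiFormula.

Variables (C : fieldType) (N : nat) (W : {pred nat}) (nu : seq nat).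
Hypothesis nuN : sumn nu = N.

Local Notation T l := (@TO C l N).

Definition block_of (k : 'I_N) : nat := reshape_index nu k.

Lemma mem_block k i : (k \in block N nu i) = (block_of k == i).
Proof. by rewrite in_block // nuN. Qed.

(** On the Young subgroup, this is the character that is the sign on the blocks of [W] and trivial
    on the others. *)
Definition wsign (s : 'S_N) : C := (-1) ^+ restr_young block_of (mem W) s.

Lemma PiE : Pi C N W nu = \sum_(s | young block_of s) wsign s *: gelt C s.
Proof.
have onE i s : perm_on (block N nu i) s = young_on block_of (pred1 i) s.
  have E : block N nu i = union_of block_of (pred1 i).
    by apply/setP => k; rewrite mem_block !inE.
  rewrite /young_on -E; apply/idP/andP => [on|[]//]; split=> //.
  apply/youngP => k; have [kB|kB] := boolP (k \in block N nu i); last first.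
    by rewrite (out_perm on).
  have skB : s k \in block N nu i by rewrite (perm_closed _ on).
  by move: kB skB; rewrite !mem_block => /eqP -> /eqP ->.
rewrite /Pi.
have -> : \big[@gmul C N/gelt C 1%g]_(0 <= i < size nu | i \in W) Esym C (block N nu i)
  = \sum_(s | young_on block_of [pred i in index_iota 0 (size nu) | i \in W] s)
      (-1) ^+ (true && s) *: gelt C s.
  rewrite -(@gmul_young_big _ _ _ _ _ (mem W)) ?iota_uniq //; apply: eq_bigr => i _.
  by apply: eq_bigl => s.
have -> : \big[@gmul C N/gelt C 1%g]_(0 <= i < size nu | i \notin W) Hsym C (block N nu i)
  = \sum_(s | young_on block_of [pred i in index_iota 0 (size nu) | i \notin W] s)
      (-1) ^+ (false && s) *: gelt C s.
  rewrite -(@gmul_young_big _ _ _ _ _ (predC (mem W))) ?iota_uniq //; apply: eq_bigr => i _.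
  by apply: eq_big => s; rewrite ?onE // scale1r.
have b_lt k : block_of k \in index_iota 0 (size nu).
  by rewrite mem_index_iota; apply: reshape_indexP; rewrite nuN.
rewrite gmul_young => [|x /= /andP[_ ->]]; last by rewrite andbF.
apply: eq_big => s.
  apply/andP/idP => [[]//|ys]; split=> //; apply/subsetP => k _.
  by rewrite inE /= b_lt /= orbN.
move=> _; rewrite mulr1; congr ((-1) ^+ (nat_of_bool (odd_perm (restr_perm _ s))) *: _).
by apply/setP => k; rewrite !inE b_lt.
Qed.

Lemma wsignM s t : young block_of s -> young block_of t ->
  wsign (s * t)%g = wsign s * wsign t.
Proof. by move=> ys yt; rewrite /wsign restr_youngM // odd_permM signr_addb. Qed.

Lemma galg_act_PiE l (t : tensor C l N) :
  galg_act (Pi C N W nu) t = \sum_(s | young block_of s) wsign s *: perm_act s t.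
Proof.
rewrite PiE /galg_act [RHS]big_mkcond; apply: eq_bigr => s _.
rewrite sum_ffunE; case: ifP => ys; last first.
  rewrite big1 ?scale0r // => u yu; rewrite 2!ffunE.
  by case: eqP => [e|]; [rewrite e yu in ys | rewrite scaler0].
rewrite (bigD1 s) //= big1 => [|u /andP[_ /negbTE ne]]; rewrite 2!ffunE.
  by rewrite eqxx addr0 /GRing.scale /= mulr1.
by rewrite eq_sym ne scaler0.
Qed.

(** Translation of the sum by [s]; the character takes the values 1 and -1, so [wsign s] is its own
    inverse. *)
Lemma galg_act_Pi_perm l s (t : tensor C l N) : young block_of s ->
  galg_act (Pi C N W nu) (perm_act s t) = wsign s *: galg_act (Pi C N W nu) t.
Proof.
move=> ys; rewrite !galg_act_PiE scaler_sumr [RHS](reindex_inj (mulIg s)) /=.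
apply: eq_big => u.
  apply/idP/idP => [yu|yus]; first exact: youngM.
  by rewrite -(mulgK s u); apply/youngM/youngV.
move=> yu; rewrite perm_actM scalerA wsignM // mulrCA -expr2.
by rewrite /wsign sqrr_sign mulr1.
Qed.

Lemma wsign_tperm k m : block_of k = block_of m -> k != m ->
  wsign (tperm k m) = if block_of k \in W then -1 else 1.
Proof.
move=> e km; have yt := young_tperm e.
case: ifP => kW; rewrite /wsign.
  rewrite (_ : restr_young _ _ _ = tperm k m) ?odd_tperm ?km ?expr1 //.
  apply/permP => j; rewrite restr_youngE //; case: ifPn => // jW.
  by case: tpermP => // jE; rewrite jE -?e /= kW in jW.
rewrite (_ : restr_young _ _ _ = 1%g) ?odd_perm1 ?expr0 //.
apply/permP => j; rewrite restr_youngE // perm1; case: ifPn => // jW.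
by case: tpermP => // jE; rewrite jE -?e /= kW in jW.
Qed.

End PiFormula.
(** * Rearrangement and conjugacy of matchings *)

(* [Q] records what survives swapping two indices at which [f], or [g] after
   [u], takes equal values; the equality case of the inequality says that [u]
   is reached from the identity by such swaps. *)
Lemma rearrangement (I : finType) (X : eqType) (w : I -> X) (f g : I -> int)
    (Q : {perm I} -> Prop) (S := fun u : {perm I} => \sum_k f k * g (u k)) :
  (forall k k', w k = w k' -> f k < f k' -> g k' <= g k) ->
  Q 1%g ->
  (forall (u : {perm I}) k k', (forall j, w (u j) = w j) -> k != k' ->
     w k = w k' -> f k = f k' \/ g (u k) = g (u k') ->
     Q (tperm k k' * u)%g -> Q u) ->
  forall u : {perm I}, (forall j, w (u j) = w j) ->
    S 1%g <= S u /\ (S u = S 1%g -> Q u).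
Proof.
move=> anti Q1 Qstep u; move: {-1}#|_| (leqnn #|[set k | u k != k]|) => n.
elim: n u => [|n IH] u.
  rewrite leqn0 cards_eq0 => /eqP/setP supp0 _.
  have -> : u = 1%g by apply/permP => k; have := supp0 k;
    rewrite !inE perm1 => /negbFE/eqP.
  by [].
move=> un wu; have [k1 uk1|fixu] := pickP [pred k | u k != k]; last first.
  apply: IH => //; rewrite (_ : [set k | _] = set0) ?cards0 //.
  by apply/setP => k; rewrite !inE; have := fixu k.
(* Among the moved indices, [k0] has the least [f] and, among those, the largest [g]. A swap makes
   [k0] a fixed point; it lowers the sum by a product of two nonnegative differences, and if that
   product is zero then one of the ties required by [Qstep] occurs. *)
have [k2 /= uk2 min_f] := arg_minP f uk1.
have [k0 /= /andP[uk0 /eqP f02] max_g] :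
    { k0 | (u k0 != k0) && (f k0 == f k2)
         & forall k, u k != k -> f k = f k2 -> g k <= g k0 }.
  have p2 : (u k2 != k2) && (f k2 == f k2) by rewrite uk2 eqxx.
  have [k0 p0 mx] := @arg_maxP _ _ _ k2 [pred k | (u k != k) && (f k == f k2)] g p2.
  by exists k0 => // k nk fk; apply: mx; rewrite /= nk fk eqxx.
pose k' := (u^-1)%g k0; have uk' : u k' = k0 by rewrite permKV.
have kk' : k0 != k' by apply: contraNneq uk0 => e; rewrite {1}e uk'.
have uuk0 : u (u k0) != u k0 by rewrite (inj_eq perm_inj).
have f_le : f k0 <= f k' by rewrite f02 min_f //= uk'.
have g_le : g (u k0) <= g k0.
  have := min_f _ uuk0; rewrite -f02 le_eqVlt => /orP[/eqP e|lt].
    by apply: max_g; rewrite // -e.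
  exact: anti lt.
pose v := (tperm k0 k' * u)%g.
have vE j : j != k0 -> j != k' -> v j = u j.
  by move=> j0 j'; rewrite permM tpermD // eq_sym.
have v0 : v k0 = k0 by rewrite permM tpermL.
have v' : v k' = u k0 by rewrite permM tpermR.
have wk' : w k0 = w k' by rewrite -(wu k') uk'.
have wv j : w (v j) = w j.
  have [->|j0] := eqVneq j k0; first by rewrite v0.
  have [->|j'] := eqVneq j k'; first by rewrite v' wu.
  by rewrite vE.
have [|Sv Qv] := IH v _ wv.
  rewrite -ltnS; apply: leq_trans un; apply: proper_card.
  apply/properP; split.
    apply/subsetP => j; rewrite !inE; have [->|j0] := eqVneq j k0; first by rewrite v0 eqxx.
    have [->|j'] := eqVneq j k'; first by rewrite uk'.
    by rewrite vE.
  by exists k0; rewrite inE ?v0 ?eqxx.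
have SE : S u = S v + (f k' - f k0) * (g k0 - g (u k0)).
  have SD (x : {perm I}) : S x = f k0 * g (x k0) + (f k' * g (x k')
      + \sum_(i | (i != k0) && (i != k')) f i * g (x i)).
    by rewrite /S (bigD1 k0) //= (bigD1 k') //= eq_sym.
  rewrite !SD v0 v' uk'.
  have -> : \sum_(i | (i != k0) && (i != k')) f i * g (u i)
          = \sum_(i | (i != k0) && (i != k')) f i * g (v i).
    by apply: eq_bigr => i /andP[i0 i']; rewrite vE.
  by ring.
have ge0 : 0 <= (f k' - f k0) * (g k0 - g (u k0)).
  by rewrite mulr_ge0 ?subr_ge0.
split=> [|e]; first by rewrite SE (le_trans Sv) // lerDl.
have z : (f k' - f k0) * (g k0 - g (u k0)) = 0.
  by apply/eqP; rewrite eq_le ge0 andbT; rewrite SE in e; lia.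
apply: (Qstep u k0 k') => //; last by apply: Qv; rewrite -e SE z addr0.
move/eqP: z; rewrite mulf_eq0 !subr_eq0 => /orP[/eqP ->|/eqP e0]; [by left | right].
by rewrite uk' e0.
Qed.

Lemma equal_fibers_perm (N : nat) (X : eqType) (F F' : 'I_N -> X) :
  (forall x, #|[set k | F k == x]| = #|[set k | F' k == x]|) ->
  exists s : 'S_N, forall k, F (s k) = F' k.
Proof.
move=> e; pose t := [tuple F k | k < N]; pose t' := [tuple F' k | k < N].
have cE (G : 'I_N -> X) x : count_mem x [tuple G k | k < N] = #|[set k | G k == x]|.
  by rewrite /= count_map cardsE cardE enumT /enum_mem size_filter; apply: eq_count.
have : perm_eq t' t by apply/allP => x _; rewrite /= -/t -/t' !cE e.
case/tuple_permP => s ts; exists s => k.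
have /(congr1 (fun r => nth (F k) r k)) := ts.
by rewrite -!tnth_nth !tnth_mktuple.
Qed.

Section MatchingConjugacy.

Variables (N : nat) (b : 'I_N -> nat).

Implicit Types (s : 'S_N).

Local Notation matching := (@matching N [set: 'I_N]).

Lemma matchingTP s : reflect (forall k, s (s k) = k /\ s k != k) (matching s).
Proof.
by apply: (iffP (matchingP _ _)) => h k; have [-> e] := h k; move: e;
  rewrite inE.
Qed.

Definition pair_count s i j := #|[set k | (b k == i) && (b (s k) == j)]|.

(* Selects one end of each pair of [s]. *)
Definition half s (k : 'I_N) :=
  (b k < b (s k))%N || (b k == b (s k)) && (k < s k)%N.

Lemma half_matching s k : matching s -> half s (s k) = ~~ half s k.
Proof.
move=> /matchingTP/(_ k)[ssk sk]; rewrite /half ssk.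
have : (s k != k :> nat) by [].
by case: ltngtP => //= _; case: ltngtP.
Qed.

(** Between different blocks the order of the blocks decides which end is selected; within a block,
    [s] exchanges the selected ends with the others. Hence [pair_count] determines the refined
    count. *)
Lemma pair_count_half s i j (h : bool) : matching s ->
  #|[set k | (b k, b (s k), half s k) == (i, j, h)]|
  = if (i < j)%N then if h then pair_count s i j else 0
    else if (j < i)%N then if h then 0 else pair_count s i j
    else (pair_count s i j)./2.
Proof.
move=> ms; have [lt|gt|<-{j}] := ltngtP i j.
- case: h; last first.
    apply: eq_card0 => k; rewrite !inE !xpair_eqE /half.
    by apply/negP => /andP[/andP[/eqP bi /eqP bj]]; rewrite bi bj lt.
  apply: eq_card => k; rewrite !inE !xpair_eqE /half.
  by case: eqP => //= ->; case: eqP => //= ->; rewrite lt.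
- case: h.
    apply: eq_card0 => k; rewrite !inE !xpair_eqE /half.
    apply/negP => /andP[/andP[/eqP bi /eqP bj]]; rewrite bi bj.
    by rewrite ltnNge (ltnW gt) /= gtn_eqF.
  apply: eq_card => k; rewrite !inE !xpair_eqE /half.
  case: eqP => //= ->; case: eqP => //= ->.
  by rewrite ltnNge (ltnW gt) /= gtn_eqF.
pose A h := [set k | (b k, b (s k), half s k) == (i, i, h)].
have AC : #|A (~~ h)| = #|A h|.
  rewrite -[RHS](card_preimset _ (@perm_inj _ s)); apply: eq_card => k.
  rewrite !inE !xpair_eqE half_matching //.
  have [-> _] := matchingTP _ ms k.
  by rewrite (andbC (b (s k) == i)); case: (half s k); case: (h).
suff -> : pair_count s i i = (#|A h|).*2 by rewrite doubleK.
rewrite -addnn -{1}AC -cardsUI (_ : A _ :&: A _ = set0) ?cards0 ?addn0.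
  apply: eq_card => k; rewrite !inE !xpair_eqE -andb_orr.
  by case: (half s k); case: (h); rewrite /= andbT.
by apply/setP => k; rewrite !inE !xpair_eqE; case: (half s k); case: (h); rewrite /= ?andbF.
Qed.

(** A permutation [r] compatible with the labels and the halves is kept on the selected end of each
    pair and transported to the other end by the two matchings; the result intertwines them. *)
Lemma matching_conj s s' : matching s -> matching s' ->
  (forall i j, pair_count s i j = pair_count s' i j) ->
  exists2 u, young b u & s' = (u * s * u^-1)%g.
Proof.
move=> ms ms' e.
have [k|r rE] := @equal_fibers_perm N _ (fun k => (b k, b (s k), half s k))
  (fun k => (b k, b (s' k), half s' k)).
  by case: k => [[i j] h]; rewrite !pair_count_half ?e.
have sK k : s (s k) = k by have [] := matchingTP _ ms k.
have sK' k : s' (s' k) = k by have [] := matchingTP _ ms' k.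
pose f k := if half s' k then r k else s (r (s' k)).
have rb k : b (r k) = b k by case: (rE k).
have rbs k : b (s (r k)) = b (s' k) by case: (rE k).
have rh k : half s (r k) = half s' k by case: (rE k).
have fh k : half s (f k) = half s' k.
  rewrite /f; case: ifPn => kh; first by rewrite rh.
  by rewrite half_matching // rh half_matching // kh.
have f_inj : injective f.
  move=> k k' ff; have := fh k; rewrite ff fh => hh; move: ff; rewrite /f hh.
  by case: ifP => _; [move/perm_inj | move/perm_inj/perm_inj/perm_inj].
exists (perm f_inj).
  apply/youngP => k; rewrite permE /f; case: ifP => _; first exact: rb.
  by rewrite rbs sK'.
apply/permP => k; rewrite !permM; apply: (@perm_inj _ (perm f_inj)).
rewrite permKV !permE /f half_matching //.
by case: (half s' k); rewrite /= ?sK' ?sK.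
Qed.

(** For [b] the block index, these are the matchings whose multiset of pairs lies in [MO W nu 0]. *)
Definition proper_matching (W : {pred nat}) s :=
  [/\ matching s, forall k, b k \in W -> b (s k) != b k
    & forall k k', b k = b k' -> b (s k) = b (s k') ->
        (b k \in W) != (b (s k) \in W) -> k = k'].

(* [z] acts in the same way at both ends of the pairs joining two blocks of [W],
   and fixes the pairs joining such a block to another one. *)
Lemma odd_restr_centralizer (W : {pred nat}) s z :
  proper_matching W s -> young b z -> (z * s = s * z)%g ->
  restr_young b (mem W) z = false :> bool.
Proof.
move=> [ms ne inj] yz zs; have /youngP yzE := yz.
have sK k : s (s k) = k by have [] := matchingTP _ ms k.
have zsk k : z (s k) = s (z k) by rewrite -!permM zs.
pose B k := (b k, b (s k)).
pose P := [pred x : nat * nat | [&& x.1 \in W, x.2 \in W & (x.1 < x.2)%N]].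
have yB : young B z by apply/youngP => k; rewrite /B -zsk !yzE.
have sV : (s^-1 = s)%g by apply/permP => k; apply: (@perm_inj _ s); rewrite permKV sK.
(* A permutation of the lower ends of the pairs inside [W], times its conjugate by [s] on the upper
   ends: the signs cancel. *)
have -> : restr_young b (mem W) z = (restr_young B P z * restr_young B P z ^ s)%g.
  apply/permP => k; rewrite /conjg sV !permM [LHS]restr_youngE //=.
  have yE j : P (B j) -> restr_young B P z j = z j.
    by move=> Pj; rewrite restr_youngE // Pj.
  have nE j : ~~ P (B j) -> restr_young B P z j = j.
    by move=> Pj; rewrite restr_youngE // (negbTE Pj).
  have bzs j : b (s (z j)) = b (s j) by rewrite -zsk yzE.
  case: ifPn => kW; last first.
    rewrite (nE k) /= ?(negbTE kW) // (nE (s k)) ?sK //.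
    by rewrite /= sK (negbTE kW) andbF.
  have [skW|skW] := boolP (b (s k) \in W); last first.
    rewrite (nE k) /= ?(negbTE skW) ?andbF // (nE (s k)) ?sK /= ?(negbTE skW) //.
    by apply: inj; rewrite ?yzE ?bzs // kW (negbTE skW).
  have := ne _ kW; case: ltngtP => // lt _.
    rewrite (nE k) /= ?(yE (s k)) /= ?sK ?skW ?kW //; first by rewrite zsk sK.
    by rewrite -leqNgt ltnW.
  rewrite (yE k) /= ?skW ?kW // (nE (s (z k))) ?sK //=.
  by rewrite sK !yzE ?bzs skW kW -leqNgt ltnW.
by rewrite odd_permM odd_permJ addbb.
Qed.

End MatchingConjugacy.
(** * Spanning *)

Section Straightening.

Variables (C : numFieldType) (l N : nat) (W : {pred nat}) (nu : seq nat).
Hypothesis nuN : sumn nu = N.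

Local Notation tensor := (tensor C l N).
Local Notation b := (@block_of N nu).
Local Notation matching := (@matching N [set: 'I_N]).

Definition PT (s : 'S_N) : tensor := galg_act (Pi C N W nu) (@TO C l N s).

Implicit Types (s u : 'S_N).

Lemma matching_conjg s u : matching s -> matching (u * s * u^-1)%g.
Proof.
move=> /matchingTP ms; apply/matchingTP => k; rewrite !permM permKV.
have [-> ne] := ms (u k); rewrite permK; split=> //.
by rewrite (can2_eq (permKV u) (permK u)).
Qed.

Lemma PT_conj s u : young b u -> PT (u * s * u^-1)%g = wsign C W nu u *: PT s.
Proof. by move=> yu; rewrite /PT -perm_act_TO galg_act_Pi_perm. Qed.

Lemma eqN_tensor0 (t : tensor) : t = - t -> t = 0.
Proof.
move=> e; have /eqP : (2%:R : C) *: t = 0 by rewrite scaler_nat mulr2n {2}e subrr.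
by rewrite scaler_eq0 pnatr_eq0 /= => /eqP.
Qed.

(** A [z] in the Young subgroup that commutes with [s] and has [wsign] -1 gives [PT s = - PT s]. For
    a pair inside a block of [W], [z] swaps its ends; for two parallel pairs between a block in [W]
    and one outside, [z] swaps them at both ends. *)
Lemma PT_improper s : matching s -> ~ proper_matching b W s -> PT s = 0.
Proof.
move=> ms imp; have sK k : s (s k) = k by have [] := matchingTP _ ms k.
have sN k : s k != k by have [] := matchingTP _ ms k.
have central z : young b z -> (z * s = s * z)%g -> wsign C W nu z = -1 -> PT s = 0.
  move=> yz zs zN; apply: eqN_tensor0.
  by rewrite -scaleN1r -zN -PT_conj // zs mulgK.
have tJ k m : (tperm k m * s = s * tperm (s k) (s m))%g.
  by rewrite -tpermJ conjgE !mulgA mulgV mul1g.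
apply: contra_notP imp => nz; split=> //.
  move=> k kW; apply/eqP => e; apply: nz; apply: (central (tperm k (s k))).
  - exact: young_tperm.
  - by rewrite tJ sK tpermC.
  - by rewrite wsign_tperm ?kW // eq_sym.
move=> k k' bk bsk kW; apply/eqP/negP => /negP ne; apply: nz.
have nes : s k != s k' by rewrite (inj_eq perm_inj).
have skk' : s k != k' by apply: contraNneq kW => e; rewrite bk -e.
apply: (central (tperm k k' * tperm (s k) (s k'))%g).
- by apply: youngM; apply: young_tperm.
- rewrite -mulgA tJ !sK mulgA tJ -!mulgA; congr (_ * _)%g.
  apply: (@perm_onC _ [set s k; s k'] [set k; k']); try exact: tperm_on.
  rewrite -setI_eq0; apply/eqP/setP => j; rewrite !inE.
  apply/negP => /andP[/orP[]/eqP -> /orP[]]; rewrite ?(negbTE (sN _)) ?(negbTE skk') //.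
  by rewrite (can2_eq sK sK) eq_sym (negbTE skk').
- rewrite wsignM ?young_tperm // !wsign_tperm //.
  by move: kW; case: (b k \in W); case: (b (s k) \in W); rewrite ?mulr1 ?mul1r.
Qed.

(** Two pairs exchange partners either way. A swap of [k] and [k'] can thus be traded for one of
    their partners when only the partners share a block. *)
Lemma tperm_conj_matching s k k' : matching s ->
  s k \notin [set k; k'] /\ s k' \notin [set k; k'] ->
  (tperm k k' * s * (tperm k k')^-1
   = tperm (s k) (s k') * s * (tperm (s k) (s k'))^-1)%g.
Proof.
move=> /matchingTP ms [sk sk'].
have ss : (s * s = 1)%g by apply/permP => j; rewrite permM perm1; case: (ms j).
have sV : (s^-1)%g = s by apply/eqP; rewrite eq_invg_mul ss.
have tJ : tperm (s k) (s k') = (s * tperm k k' * s)%g.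
  by rewrite -tpermJ conjgE sV mulgA.
have tC : (tperm k k' * tperm (s k) (s k') = tperm (s k) (s k') * tperm k k')%g.
  apply: (@perm_onC _ [set k; k'] [set s k; s k']); try exact: tperm_on.
  rewrite -setI_eq0; apply/eqP/setP => j; rewrite in_setI in_set0.
  apply/negP => /andP[jk]; rewrite !inE => /orP[]/eqP e; rewrite e in jk.
    by rewrite jk in sk.
  by rewrite jk in sk'.
rewrite !tpermV; transitivity (s * (tperm k k' * tperm (s k) (s k')))%g.
  by rewrite tC tJ !mulgA ss mul1g.
by rewrite [in RHS]tJ -{2}tJ -!mulgA (mulgA s s (tperm _ _)) ss mul1g.
Qed.

Lemma PT_pair_count s s' : matching s -> matching s' ->
  (forall i j, pair_count b s i j = pair_count b s' i j) -> PT s' \in <[PT s]>%VS.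
Proof.
move=> ms ms' e; have [u yu ->] := matching_conj ms ms' e.
by rewrite PT_conj // memvZ ?memv_line.
Qed.

(** Pigeonhole: a word has equal letters at two positions of [K], and their transposition pairs off
    the terms with opposite signs. *)
Lemma antisym_sum0 (K : {set 'I_N}) (t : tensor) : (l < #|K|)%N ->
  \sum_(s : 'S_N | perm_on K s) (-1) ^+ s *: perm_act s t = 0 :> tensor.
Proof.
move=> lK; apply/ffunP => w; rewrite sum_ffunE [RHS]ffunE.
have [k kK [k' /andP[ne k'K] wk]] :
    exists2 k, k \in K & exists2 k', k' \in [predD1 K & k] & w k = w k'.
  apply/dinjectivePn/negP => /dinjectiveP winj.
  by move: lK; rewrite -(card_in_imset winj) ltnNge (leq_trans (max_card _)) ?card_ord.
pose F s : C := (-1) ^+ s * t (perm_word s^-1 w).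
under eq_bigr => s _ do rewrite ffunE perm_act_coef -[_ *: _]/(F s).
suff : \sum_(s : 'S_N | perm_on K s) F s = - \sum_(s : 'S_N | perm_on K s) F s.
  set x := \sum_(s | _) _ => e; have /eqP : x *+ 2 = 0 by rewrite mulr2n {2}e subrr.
  by rewrite mulrn_eq0 => /eqP.
rewrite {1}(reindex_inj (mulgI (tperm k k'))) -sumrN /=.
have tK : perm_on K (tperm k k').
  by apply: subset_trans (tperm_on k k') _; apply/subsetP => j;
    rewrite !inE => /orP[]/eqP ->.
apply: eq_big => s.
  apply/idP/idP => [ts|sK]; last exact: perm_onM.
  by rewrite -(mulKg (tperm k k') s) tpermV; apply: perm_onM.
move=> _; rewrite /F odd_permM odd_tperm eq_sym ne /= signrN mulNr.
congr (- (_ * t _)).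
rewrite invMg perm_wordM tpermV; congr perm_word; apply/ffunP => j; rewrite ffunE.
by case: tpermP => // ->.
Qed.

Definition Phi s : int := \sum_k (b k)%:Z * (b (s k))%:Z.

Lemma Phi_ge0 s : 0 <= Phi s.
Proof. by apply: sumr_ge0 => k _. Qed.

Lemma straightening s (K : {set 'I_N}) (U : {vspace tensor}) :
  matching s -> (l < #|K|)%N ->
  (forall k, k \in K -> s k \notin K) ->
  (forall k k', k \in K -> k' \in K -> k != k' ->
     [/\ b k = b k' -> b k \in W, b (s k) = b (s k') -> b (s k) \in W
       & (b k < b k')%N -> (b (s k) <= b (s k'))%N]) ->
  (forall s', matching s' -> Phi s' < Phi s -> PT s' \in U) ->
  PT s \in U.
Proof.
move=> ms lK disj comp lower.
have sK k : s (s k) = k by have [] := matchingTP _ ms k.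
pose sc u := (u * s * u^-1)%g.
have scE u k : sc u k = (u^-1)%g (s (u k)) by rewrite !permM.
(* Data for the rearrangement inequality: [w] confines the permutations to [K], [f] vanishes off
   [K], and the sign in [g] turns the increasing order along the chain into the decreasing one. *)
pose f k : int := if k \in K then (b k)%:Z else 0.
pose g k : int := - (b (s k))%:Z.
pose w k := if k \in K then None else Some k.
have wK u : (forall j, w (u j) = w j) -> perm_on K u.
  move=> wu; apply/subsetP => k; rewrite inE; apply: contraR => kK.
  by have := wu k; rewrite /w (negbTE kK); case: ifP => // _ [->].
have Kw u : perm_on K u -> forall j, w (u j) = w j.
  move=> on j; rewrite /w (perm_closed _ on); case: ifPn => // jK.
  by rewrite (out_perm on).
have scK u k : perm_on K u -> k \in K -> sc u k = s (u k).
  move=> on kK; rewrite scE; apply: (@out_perm _ K); first exact: perm_onV.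
  by rewrite disj // (perm_closed _ on).
have scO u k : perm_on K u -> k \notin K -> s k \notin K -> sc u k = s k.
  move=> on kK skK; rewrite scE (out_perm on) //.
  by apply: (@out_perm _ K) => //; exact: perm_onV.
pose S u : int := \sum_k f k * g (u k).
pose rest : int := \sum_(k | (k \notin K) && (s k \notin K)) (b k)%:Z * (b (s k))%:Z.
(* A pair that meets [K] has one end in it and enters [Phi] from both ends, hence the factor 2; the
   remaining pairs do not depend on [u]. *)
have PhiS u : perm_on K u -> Phi (sc u) = rest - S u *+ 2.
  move=> on; have scI := matchingTP _ (matching_conjg u ms).
  have KS : \sum_(k in K) (b k)%:Z * (b (sc u k))%:Z = - S u.
    rewrite /S -sumrN big_mkcond; apply: eq_bigr => k _.
    rewrite /f /g; case: ifP => kK; last by rewrite mul0r oppr0.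
    by rewrite scK // mulrN opprK.
  rewrite /Phi (bigID (mem K)) /= KS (bigID (fun k => s k \in K)) /=.
  have -> : \sum_(k | (k \notin K) && (s k \in K)) (b k)%:Z * (b (sc u k))%:Z = - S u.
    rewrite -KS (reindex_inj (@perm_inj _ (sc u))); apply: eq_big => k.
      apply/andP/idP => [[k1 k2]|kK]; last first.
        rewrite !scK // sK (perm_closed _ on) kK; split=> //.
        by rewrite disj // (perm_closed _ on).
      have [<- _] := scI k; set m := sc u k in k1 k2 *.
      by rewrite scE (out_perm on k1) -(perm_closed _ on) permKV.
    by move=> _; rewrite mulrC; case: (scI k) => ->.
  have -> : \sum_(k | (k \notin K) && (s k \notin K)) (b k)%:Z * (b (sc u k))%:Z = rest.
    by apply: eq_bigr => k /andP[k1 k2]; rewrite scO.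
  by ring.
pose Q u := ((-1) ^+ u : C) *: PT (sc u) = PT s.
have sc1 : sc 1%g = s by rewrite /sc invg1 mulg1 mul1g.
have rearr u : perm_on K u -> S 1%g <= S u /\ (S u = S 1%g -> Q u).
  move=> on; apply: (@rearrangement _ _ w f g Q) => //; last exact: Kw.
  - move=> k k'; rewrite /w /f /g; case: ifP => kK; case: ifP => // k'K.
    move=> _; have [->|ne] := eqVneq k k'; first by rewrite ltxx.
    by have [_ _ h] := comp _ _ kK k'K ne; rewrite ltz_nat lerN2 lez_nat.
  - by rewrite /Q odd_perm1 expr0 scale1r sc1.
  move=> {on}u k k' wu ne wk eqs; have on := wK _ wu.
  have [kK k'K] : k \in K /\ k' \in K.
    move: wk ne; rewrite /w; case: ifP => kK; case: ifP => // _ [->].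
    by rewrite eqxx.
  rewrite /Q odd_permM odd_tperm ne /= signrN scaleNr.
  (* The sign of the transposition is offset by [wsign], which is -1 because the block shared by the
     two positions, or by their partners, lies in [W]. *)
  suff -> : PT (sc (tperm k k' * u)%g) = - PT (sc u) by rewrite scalerN opprK.
  have -> : sc (tperm k k' * u)%g = (tperm k k' * sc u * (tperm k k')^-1)%g.
    by rewrite /sc invMg !mulgA.
  have [c1 c2 _] := comp _ _ kK k'K ne.
  have [bk|bsk] : b k = b k' \/ b (sc u k) = b (sc u k').
    case: eqs => [|/oppr_inj [e]]; last by right; rewrite !scK.
    by rewrite /f kK k'K => -[e]; left.
  - rewrite PT_conj ?young_tperm // wsign_tperm // c1 // scaleN1r //.
  have tE : (tperm k k' * sc u * (tperm k k')^-1
      = tperm (sc u k) (sc u k') * sc u * (tperm (sc u k) (sc u k'))^-1)%g.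
    have dis m : m \in K -> sc u m \notin K.
      by move=> mK; rewrite scK // disj // (perm_closed _ on).
    apply: tperm_conj_matching; first exact: matching_conjg.
    have kk'K : [set k; k'] \subset K by rewrite subUset !sub1set kK.
    by split; apply: contra (subsetP kk'K _) _; apply: dis.
  have uk : u k != u k' by rewrite (inj_eq perm_inj).
  have [ukK uk'K] : u k \in K /\ u k' \in K by rewrite !(perm_closed _ on).
  have [_ c3 _] := comp _ _ ukK uk'K uk.
  rewrite tE PT_conj ?young_tperm // wsign_tperm //; last by rewrite (inj_eq perm_inj).
  by rewrite scK // c3 ?scaleN1r // -!scK.
have := congr1 (@galg_act C l N (Pi C N W nu)) (antisym_sum0 (@TO C l N s) lK).
rewrite linear0 linear_sum.
under eq_bigr => u _ do rewrite linearZ /= perm_act_TO -/(PT _).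
(* The terms with [S u = S 1] all equal [PT s], and [u = 1] is among them; in the others [Phi] is
   strictly smaller. *)
rewrite (bigID (fun u => S u == S 1%g)) /=.
rewrite (eq_bigr (fun=> PT s)) => [|u /andP[on /eqP Su]]; last first.
  by have [_] := rearr u on; apply.
rewrite sumr_const -scaler_nat; set c := #|_| => /eqP.
have c0 : (c%:R : C) != 0.
  rewrite pnatr_eq0 -lt0n; apply/card_gt0P; exists 1%g.
  by rewrite unfold_in /= eqxx perm_on1.
rewrite addr_eq0 => /eqP /(congr1 (fun t => c%:R^-1 *: t)).
rewrite scalerA mulVf // scale1r => ->.
apply/memvZ; rewrite memvN; apply: memv_suml => u /andP[on Su]; apply: memvZ.
apply: lower; first exact: matching_conjg.
have [le_S _] := rearr u on.
have Phi_s : Phi s = rest - S 1%g *+ 2 by rewrite -{1}sc1 PhiS ?perm_on1.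
rewrite PhiS // Phi_s.
by rewrite ltrD2l ltrN2 ltrMn2r /= lt_neqAle le_S eq_sym Su.
Qed.

End Straightening.

(** * Multisets of pairs and chains of positions *)

Local Open Scope nat_scope.

(** Greedy choice: the tail of the sequence uses up fewer positions over [x] than there are. *)
Lemma uniq_lift (I : finType) (X : eqType) (p : I -> X) (s : seq X) :
  (forall x, count_mem x s <= #|[set k | p k == x]|) ->
  exists2 ks, uniq ks & map p ks = s.
Proof.
elim: s => [_|x s IH h]; first by exists [::].
have [y|ks uks pks] := IH.
  by apply: leq_trans (h y); rewrite /= leq_addl.
have [k pk kks] : exists2 k, p k = x & k \notin ks.
  suff /card_gt0P[k] : 0 < #|[set k | p k == x] :\: [set k in ks]|.
    by rewrite !inE => /andP[kks /eqP pk]; exists k.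
  rewrite cardsD subn_gt0; apply: leq_trans (h x).
  rewrite /= eqxx add1n ltnS -pks count_map.
  rewrite (_ : _ :&: _ = [set k in [seq k <- ks | p k == x]]).
    by rewrite cardsE (leq_trans (card_size _)) // size_filter.
  by apply/setP => k; rewrite !inE mem_filter.
by exists (k :: ks); rewrite /= ?kks // pk pks.
Qed.

Section Multisets.

Variables (N : nat) (W : {pred nat}) (nu : seq nat).
Hypothesis nuN : sumn nu = N.

Local Notation b := (@block_of N nu).
Local Notation matching := (@matching N [set: 'I_N]).
Local Notation proper := (proper_matching b W).

Implicit Types (s : 'S_N) (M : {mset nat * nat}).

Lemma card_block i : #|[set k : 'I_N | b k == i]| = nth 0 nu i.
Proof.
have <- : block N nu i = [set k | b k == i].
  by apply/setP => k; rewrite mem_block // inE.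
have sub j : sumn (take j nu) <= N.
  by rewrite -nuN -{2}(cat_take_drop j nu) sumn_cat leq_addr.
have -> : #|block N nu i| = sumn (take i.+1 nu) - sumn (take i nu).
  rewrite -sum1dep_card -(big_ord_widen_cond _ (fun k => sumn (take i nu) <= k) (fun=> 1)) //.
  by rewrite -[RHS]muln1 -sum_nat_const_nat (big_geq_mkord _ _ xpredT).
have [lt|ge] := ltnP i (size nu).
  by rewrite (take_nth 0) // sumn_rcons addKn.
by rewrite !take_oversize ?nth_default ?subnn // ltnW.
Qed.

Lemma representsP s M :
  represents nu s M <->
  matching s /\ forall i j, M (i, j) = pair_count b s i j.
Proof.
have cE i j : #|[set k in block N nu i | s k \in block N nu j]| = pair_count b s i j.
  by apply: eq_card => k; rewrite !inE -!mem_block // !inE.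
split=> [[f h]|[/matchingTP f h]]; first by split=> [|i j]; [apply/matchingTP | rewrite h cE].
by split=> // i j; rewrite h cE.
Qed.

Lemma pair_count_sym s i j : matching s -> pair_count b s i j = pair_count b s j i.
Proof.
move=> /matchingTP ms; rewrite /pair_count -[LHS](card_preimset _ (@perm_inj _ s)).
by apply: eq_card => k; rewrite !inE; case: (ms k) => ->; rewrite andbC.
Qed.

Lemma MO_proper s M : MO W nu 0 M -> represents nu s M -> proper s.
Proof.
move=> [_ comp _ fix0] /representsP[ms cM]; split=> // [k kW|k k' bk bsk ne].
  apply/eqP => e; have : 0 < M (b k, b k).
    by rewrite cM; apply/card_gt0P; exists k; rewrite inE e eqxx.
  rewrite mset_gt0 => kM; move/eqP: fix0; rewrite addn_eq0 => /andP[/eqP c0 _].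
  have : has (fun p => (p.1 == p.2) && (p.1 \in W)) M.
    by apply/hasP; exists (b k, b k); rewrite //= eqxx kW.
  by rewrite has_count c0.
have := comp _ _ ne; rewrite cM => /card_le1_eqP; apply; rewrite inE ?eqxx //.
by rewrite bk bsk !eqxx.
Qed.

Definition mset_of s : {mset nat * nat} :=
  seq_mset [seq (b k, b (s k)) | k <- enum 'I_N].

Lemma mset_of_count s i j : mset_of s (i, j) = pair_count b s i j.
Proof.
rewrite /mset_of mset_seqE count_map /pair_count cardE enumT size_filter.
by rewrite -enumT; apply: eq_count => k; rewrite /= inE.
Qed.

Lemma count_mset_of s (P : pred (nat * nat)) :
  count P (mset_of s) = #|[set k | P (b k, b (s k))]|.
Proof.
rewrite (seq.permP (perm_eq_seq_mset _)) count_map cardE enumT size_filter -enumT.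
by apply: eq_count => k; rewrite /= inE.
Qed.

Lemma proper_MO s : proper s -> MO W nu 0 (mset_of s).
Proof.
move=> [ms ne inj]; split.
- by move=> i j; rewrite !mset_of_count pair_count_sym.
- move=> i j ij; rewrite mset_of_count; apply/card_le1_eqP => k k'.
  rewrite !inE => /andP[/eqP bk /eqP bsk] /andP[/eqP bk' /eqP bsk'].
  by apply: inj; rewrite ?bk ?bk' ?bsk ?bsk'.
- by move=> i; rewrite count_mset_of card_block.
rewrite /fixed_points count_mset_of eq_card0 => [|k]; last first.
  by rewrite !inE /=; apply/negP => /andP[/eqP e /ne]; rewrite e eqxx.
rewrite add0n (eq_count (a2 := pred0)) ?count_pred0 // => -[i j] /=.
apply/negP => /and3P[/eqP <- _]; apply/negP; rewrite mset_of_count.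
(* The matching permutes the positions counted on the diagonal without fixed points, so the
   multiplicity is even. *)
apply: (@involution_card_even _ s) => k; rewrite !inE => /andP[bk bsk].
by have [-> sk] := matchingTP _ ms k; rewrite bk bsk.
Qed.

Lemma mset_of_eq s M : represents nu s M -> mset_of s = M.
Proof.
by move=> /representsP[_ h]; apply/msetP => -[i j]; rewrite mset_of_count h.
Qed.

Definition pair_at s (k : 'I_N) := (b k, b (s k)).

Lemma card_pair_at s x : #|[set k | pair_at s k == x]| = mset_of s x.
Proof.
case: x => i j; rewrite mset_of_count; apply: eq_card => k.
by rewrite !inE xpair_eqE.
Qed.

Lemma size_chain_ell s ks : uniq ks -> sorted (WW_step W) (map (pair_at s) ks) ->
  size ks <= ell W (mset_of s).
Proof.
move=> uks sks; pose t := map (pair_at s) ks.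
have tM x : count_mem x t <= mset_of s x.
  rewrite -card_pair_at /t count_map -size_filter.
  rewrite -(card_uniqP (filter_uniq _ uks)); apply: subset_leq_card.
  by apply/subsetP => k; rewrite mem_filter inE => /andP[].
have tsize : size t < (size (mset_of s)).+1.
  have [x|u /size_subseq le_u /perm_size ->] := (count_subseqP t (mset_of s)).1.
    by rewrite count_mem_mset.
  by rewrite ltnS.
rewrite -(size_map (pair_at s)) -/t.
apply: (@leq_bigmax_cond _ _ _ (Ordinal tsize)); apply/asboolP.
by exists t.
Qed.

(** A longest chain is cut to its first [l + 1] elements and lifted to distinct positions. *)
Lemma chain_of_ell s l : l < ell W (mset_of s) ->
  exists ks, [/\ uniq ks, size ks = l.+1
    & sorted (WW_step W) (map (pair_at s) ks)].
Proof.
rewrite ltnNge => /bigmax_leqP nle.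
have [k /asboolP[t [st ct] sz] lk] : exists2 k : 'I_(size (mset_of s)).+1,
    `[< exists2 s0, WW_increasing_in W (mset_of s) s0 & size s0 = k >] & l < k.
  by apply: contra_notP nle => nex k Pk; rewrite leqNgt; apply/negP => lk;
    apply: nex; exists k.
have [x|ks uks pks] := @uniq_lift _ _ (pair_at s) (take l.+1 t).
  rewrite card_pair_at; apply: leq_trans (ct x).
  by rewrite -{2}(cat_take_drop l.+1 t) count_cat leq_addr.
exists ks; split; rewrite ?pks ?take_sorted //.
by rewrite -(size_map (pair_at s)) pks size_takel // sz.
Qed.

End Multisets.

Lemma WW_step_trans W : transitive (WW_step W).
Proof.
move=> [x' y'] [x y] [x'' y''] /and4P[/= x1 y1 ex1 ey1] /and4P[/= x2 y2 ex2 ey2].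
apply/and4P; split=> /=.
- exact: leq_trans x1 x2.
- exact: leq_trans y1 y2.
- by apply/implyP => /eqP e; apply: (implyP ex1); rewrite eqn_leq x1 e.
- by apply/implyP => /eqP e; apply: (implyP ey1); rewrite eqn_leq y1 e.
Qed.

Local Open Scope ring_scope.
Lemma pairwise_or (X : eqType) (r : rel X) s x y :
  pairwise r s -> x \in s -> y \in s -> x != y -> r x y \/ r y x.
Proof.
elim: s => //= z s IH /andP[/allP zs ps]; rewrite !inE.
case/orP=> [/eqP ->|xs]; case/orP=> [/eqP ->|ys] ne; last exact: IH.
- by rewrite eqxx in ne.
- by left; apply: zs.
- by right; apply: zs.
Qed.

Section Spanning.

Variables (C : numFieldType) (l N : nat) (W : {pred nat}) (nu : seq nat).
Hypothesis nuN : sumn nu = N.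
Variable tau : {mset nat * nat} -> 'S_N.
Hypothesis htau : forall M, MO W nu 0 M -> represents nu (tau M) M.

Local Notation b := (@block_of N nu).
Local Notation matching := (@matching N [set: 'I_N]).
Local Notation proper := (proper_matching b W).
Local Notation PT := (@PT C l N W nu).

Implicit Types (s u : 'S_N).

(** Passing through permutations makes the index set a finite list; repetitions do not affect the
    span. *)
Definition basis_msets :=
  [seq M <- [seq mset_of nu s | s <- enum 'S_N]
     | `[< MO W nu 0 M /\ (ell W M <= l)%N >]].

(** Strong induction on [Phi]: an improper matching gives zero, a short chain length gives a
    multiple of a chosen element, and a chain of [l + 1] positions allows straightening. *)
Lemma PT_span s : matching s -> PT s \in <<[seq PT (tau M) | M <- basis_msets]>>%VS.
Proof.
set U := <<_>>%VS; have [n] := ubnP `|Phi nu s|%N.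
elim: n s => // n IH s ltn ms.
have [ps|nps] := pselect (proper s); last by rewrite PT_improper ?mem0v.
have MOs := proper_MO nuN ps.
have [le_l|lt_l] := leqP (ell W (mset_of nu s)) l.
  have /representsP[//|mt ct] := htau MOs.
  have tU : PT (tau (mset_of nu s)) \in U.
    apply/memv_span/map_f; rewrite mem_filter map_f ?mem_enum // andbT.
    exact/asboolP.
  apply: (subvP (_ : <[PT (tau (mset_of nu s))]> <= U)%VS); first by rewrite -memvE.
  by apply: PT_pair_count => // i j; rewrite -ct mset_of_count.
have [ks [uks sz sks]] := chain_of_ell lt_l.
rewrite (sorted_pairwise (@WW_step_trans W)) pairwise_map in sks.
have step k k' : k \in ks -> k' \in ks -> k != k' ->
    WW_step W (pair_at nu s k) (pair_at nu s k')
    \/ WW_step W (pair_at nu s k') (pair_at nu s k).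
  by move=> *; apply: pairwise_or sks _ _ _.
have [_ neW _] := ps.
apply: (@straightening C l N W nu nuN s [set k in ks]) => //.
- by rewrite cardsE (card_uniqP uks) sz.
(* If both ends of a pair were in the chain, comparing $(i,j)$ with $(j,i)$ would give $i = j$ in
   [W], which properness excludes. *)
- move=> k; rewrite !inE => kk; apply/negP => skk.
  have [ssk sk] := matchingTP _ ms k.
  have e : b k = b (s k).
    have := step _ _ skk kk sk; rewrite /WW_step /= ssk.
    by case=> /and4P[l1 l2 _ _]; apply/eqP; rewrite eqn_leq l1 l2.
  have : b k \in W.
    have := step _ _ skk kk sk; rewrite /WW_step /= ssk -e eqxx.
    by case=> /and4P[].
  by move/neW; rewrite e eqxx.
- move=> k k'; rewrite !inE => kk kk' ne.
  have [] := step _ _ kk kk' ne => /and4P[/= l1 l2 e1 e2].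
    by split=> // e; [apply: (implyP e1) | apply: (implyP e2)]; apply/eqP.
  split=> [e|e|]; last by rewrite ltnNge l1.
    by rewrite e; apply: (implyP e1); rewrite e.
  by rewrite e; apply: (implyP e2); rewrite e.
- move=> s' ms' lt; apply: IH => //.
  by have := Phi_ge0 nu s'; lia.
Qed.

End Spanning.

(** * Independence *)

Section Coloring.

Variables (l N : nat) (W : {pred nat}) (nu : seq nat).

Local Notation b := (@block_of N nu).
Local Notation proper := (proper_matching b W).

Local Open Scope nat_scope.

(** Letters serve as colours, so that a colouring is a word at which coefficients can be read. *)
Definition antichain_coloring (s : 'S_N) (w : {ffun 'I_N -> 'I_l}) :=
  (forall k, w (s k) = w k) /\
  forall k k', k != k' -> w k = w k' ->
    ~~ WW_step W (pair_at nu s k) (pair_at nu s k').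

(* Mirsky colouring by the length of the longest chain ending at a position;
   equal pairs are ordered by the smaller end of their two positions, so that
   the order, hence the colouring, is invariant under the matching. *)
Lemma antichain_coloring_exists s : proper s -> ell W (mset_of nu s) <= l ->
  exists w, antichain_coloring s w.
Proof.
move=> [ms neW inj] ell_l; have sK k : s (s k) = k by have [] := matchingTP _ ms k.
pose p := pair_at nu s; pose low (k : 'I_N) := minn k (s k).
pose R k k' := WW_step W (p k) (p k') && ((p k == p k') ==> (low k < low k')).
have Rirr : irreflexive R by move=> k; rewrite /R eqxx ltnn andbF.
have Rtr : transitive R.
  move=> k' k k'' /andP[st1 lo1] /andP[st2 lo2].
  apply/andP; split; first exact: WW_step_trans st1 st2.
  apply/implyP => /eqP e.
  have e' : p k = p k'.
    move: st1 st2; rewrite -e => /and4P[a1 a2 _ _] /and4P[a3 a4 _ _].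
    move: a1 a2 a3 a4; case: (p k) => x y; case: (p k') => x' y' /= *.
    by congr pair; apply/eqP; rewrite eqn_leq; apply/andP.
  apply: (@ltn_trans (low k')); first by apply: (implyP lo1); rewrite e'.
  by apply: (implyP lo2); rewrite -e' e.
have Rs k k' : R (s k) (s k') = R k k'.
  rewrite /R /low /p /pair_at !sK /WW_step /= !xpair_eqE.
  rewrite (minnC (s k)) (minnC (s k')).
  rewrite (andbC (b (s k) == _)); congr (_ && _).
  by rewrite andbCA; do 2!congr (_ && _); rewrite andbC.
pose Rop k k' := R k' k.
have bound k t : path Rop k t -> size t < l.
  move=> kt; apply: leq_trans ell_l; rewrite -[_.+1]/(size (k :: t)) -size_rev.
  have sR : sorted R (rev (k :: t)) by rewrite rev_sorted.
  apply: size_chain_ell; first exact: sorted_uniq sR.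
  rewrite sorted_map; apply: sub_sorted sR => i j /andP[] //.
(* The position [k] itself is not counted in the length, so the heights range over 0, ..., l - 1 and
   are letters. *)
pose good k (n : 'I_l) := [exists t : n.-tuple 'I_N, path Rop k t].
pose h k := \max_(n < l | good k n) n.
have h_ge k t : path Rop k t -> size t <= h k.
  move=> kt; have lt := bound _ _ kt.
  apply: (leq_bigmax_cond (Ordinal lt)); apply/existsP.
  by exists (in_tuple t).
have h_ex k : exists2 t, path Rop k t & size t = h k.
  have l0 : 0 < l by apply: (bound k [::]).
  have [|n /existsP[t kt] hn] := @eq_bigmax_cond _ (mem (good k)) (@nat_of_ord l).
    by apply/card_gt0P; exists (Ordinal l0); apply/existsP; exists [tuple].
  by exists t; rewrite ?size_tuple //; apply/esym/hn.
have h_lt k : h k < l by have [t kt <-] := h_ex k; apply: bound kt.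
have h_R k k' : R k k' -> h k < h k'.
  by move=> r; have [t kt <-] := h_ex k; apply: (h_ge k' (k :: t)); rewrite /= kt andbT.
have h_le k : h k <= h (s k).
  have [t kt <-] := h_ex k; rewrite -(size_map s); apply: h_ge.
  by rewrite path_map (eq_path (e' := Rop)) // => i j; apply: Rs.
have h_s k : h (s k) = h k by apply/eqP; rewrite eqn_leq h_le -{2}(sK k) h_le.
exists [ffun k => Ordinal (h_lt k)]; split=> [k|k k' ne].
  by rewrite !ffunE; apply: val_inj; rewrite /= h_s.
rewrite !ffunE => -[hh]; apply/negP => st.
(* Comparable positions of equal height have the same pair and the same smaller end, so they are the
   two ends of one pair inside a block of [W], contrary to properness. *)
have nR i j : h i = h j -> R i j = false.
  by move=> hij; apply/negP => /h_R; rewrite hij ltnn.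
have pE : p k = p k'.
  by move: (nR _ _ hh); rewrite /R st /=; case: eqP.
have lowE : low k = low k'.
  move: (nR _ _ hh) (nR _ _ (esym hh)); rewrite /R pE eqxx /= -{1}pE st /=.
  have := st; rewrite -/p pE => -> /=.
  by case: ltngtP.
have [e|e] : k' = k \/ k' = s k.
  move: lowE; rewrite /low /minn.
  case: ifP => _; case: ifP => _ /val_inj e; [left|right|right|left].
  - by [].
  - by rewrite e sK.
  - by [].
  - by apply: (@perm_inj _ s).
  by rewrite e eqxx in ne.
move: pE st; rewrite e /p /pair_at sK => -[e1 _] /and4P[_ _ /= h1 _].
by have := neW _ (implyP h1 _); rewrite e1 !eqxx => /(_ isT).
Qed.

End Coloring.

(** * Triangularity of the coefficients at the colourings *)

Lemma Phi_conj N nu (s u : 'S_N) : young (@block_of N nu) u ->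
  Phi nu (u * s * u^-1)%g = Phi nu s.
Proof.
move=> yu; have /youngP yE := yu; have /youngP yV := youngV yu.
rewrite /Phi [RHS](reindex_inj (@perm_inj _ u)); apply: eq_bigr => k _.
by rewrite yE !permM yV.
Qed.

Lemma pair_count_conj N (b : 'I_N -> nat) (s u : 'S_N) i j : young b u ->
  pair_count b (u * s * u^-1)%g i j = pair_count b s i j.
Proof.
move=> yu; have /youngP yE := yu; have /youngP yV := youngV yu.
rewrite /pair_count -[RHS](card_preimset _ (@perm_inj _ u)); apply: eq_card => k.
by rewrite !inE yE !permM yV.
Qed.

Section Triangularity.

Variables (C : numFieldType) (l N : nat) (W : {pred nat}) (nu : seq nat).
Hypothesis nuN : sumn nu = N.

Local Notation b := (@block_of N nu).
Local Notation matching := (@matching N [set: 'I_N]).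
Local Notation proper := (proper_matching b W).
Local Notation PT := (@PT C l N W nu).

Variables (s : 'S_N) (w : {ffun 'I_N -> 'I_l}).
Hypotheses (ps : proper s) (cw : antichain_coloring W nu s w).

(* The block and the colour of a position, encoded in a single number. *)
Definition colored_block (k : 'I_N) : nat := (b k * l + w k)%N.
Local Notation c := colored_block.

Lemma colored_blockP k k' : c k = c k' <-> b k = b k' /\ w k = w k'.
Proof.
split=> [e|[e1 e2]]; last by rewrite /c e1 e2.
have l0 : (0 < l)%N by apply: leq_ltn_trans (ltn_ord (w k)).
split; last apply: val_inj => /=.
  have := congr1 (divn^~ l) e.
  by rewrite /c !divnMDl // !divn_small // !addn0.
by have := congr1 (modn^~ l) e; rewrite /c !modnMDl !modn_small.
Qed.

Lemma young_colored u : young c u -> young b u /\ perm_word u w = w.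
Proof.
move=> /youngP yu; split; first by apply/youngP => k; case/colored_blockP: (yu k).
by apply/ffunP => k; rewrite ffunE; case/colored_blockP: (yu k).
Qed.

(** Rearrangement with [f] the block and [g] the block of the partner under [s], applied to
    [s' * s]: the antichain condition makes [g] decrease with [f] within a colour. In the equality
    case [Q] yields equal pair counts for the coloured blocks, hence conjugacy. *)
Lemma colored_matching_min s' : matching s' -> perm_word s' w = w ->
  Phi nu s <= Phi nu s' /\
  (Phi nu s' = Phi nu s ->
    exists2 u, young c u & s' = (u * s * u^-1)%g).
Proof.
have [ms _ _] := ps; have [ws anti] := cw; move=> ms' ws'.
have sK k : s (s k) = k by have [] := matchingTP _ ms k.
pose Q u := forall i j,
  #|[set k | (c k == i) && (c (s ((u : 'S_N) k)) == j)]| = pair_count c s i j.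
have w' k : w (s' k) = w k by rewrite -{2}ws' ffunE.
have [||||le_S QS] := @rearrangement _ _ w (fun k => (b k)%:Z)
    (fun k => (b (s k))%:Z) Q _ _ _ (s' * s)%g.
- move=> k k' wk; rewrite ltz_nat lez_nat => lt; rewrite leqNgt; apply/negP => lt'.
  have ne : k != k' by apply: contraTneq lt => ->; rewrite ltnn.
  have /negP := anti _ _ ne wk; apply; rewrite /WW_step /=.
  by rewrite (ltnW lt) (ltnW lt') !ltn_eqF.
- by move=> i j; rewrite /pair_count; apply: eq_card => k; rewrite !inE perm1.
- move=> u k k' wu ne wk eqs Qt i j; rewrite -Qt.
  case: eqs => [[bk]|[bsk]].
    have ck : c k = c k' by apply/colored_blockP.
    rewrite -[LHS](card_preimset _ (@perm_inj _ (tperm k k'))).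
    apply: eq_card => m; rewrite !inE permM; congr ((_ == _) && _).
    by case: tpermP => // ->.
  have ck : c (s (u k)) = c (s (u k')) by apply/colored_blockP; rewrite !ws !wu.
  apply: eq_card => m; rewrite !inE permM; congr (_ && (_ == _)).
  by case: tpermP => // ->.
- by move=> k; rewrite permM ws w'.
have S1 : \sum_k (b k)%:Z * (b (s ((1%g : 'S_N) k)))%:Z = Phi nu s.
  by apply: eq_bigr => k _; rewrite perm1.
have S2 : \sum_k (b k)%:Z * (b (s ((s' * s)%g k)))%:Z = Phi nu s'.
  by apply: eq_bigr => k _; rewrite permM sK.
rewrite S1 S2 in le_S QS; split=> // /QS Qs'.
apply: matching_conj => // i j; rewrite -Qs'; apply: eq_card => k.
by rewrite !inE permM sK.
Qed.

Lemma PT_coefE s' : PT s' w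
  = \sum_(u | young b u) wsign C W nu u * (perm_word (u * s' * u^-1)%g w == w)%:R.
Proof.
rewrite /PT galg_act_PiE // sum_ffunE; apply: eq_bigr => u _.
by rewrite perm_act_TO ffunE TO_coef.
Qed.

(** A nonzero coefficient requires a Young conjugate of [s'] that respects the colouring, and
    conjugation changes neither [Phi] nor the pair counts. *)
Lemma PT_coef_triangular s' : matching s' -> PT s' w != 0 ->
  Phi nu s < Phi nu s' \/ (forall i j, pair_count b s' i j = pair_count b s i j).
Proof.
move=> ms' nz.
have [u yu wu] : exists2 u, young b u & perm_word (u * s' * u^-1)%g w = w.
  apply: contra_notP (negP nz) => none; rewrite PT_coefE big1 // => u yu.
  by case: eqP => [e|]; [case: none; exists u | rewrite mulr0].
have [le_Phi eq_Phi] := colored_matching_min (matching_conjg u ms') wu.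
rewrite Phi_conj // in le_Phi eq_Phi.
have [e|ne] := eqVneq (Phi nu s') (Phi nu s); last first.
  by left; rewrite lt_neqAle eq_sym ne.
right=> i j; have [v /young_colored[yv _] e'] := eq_Phi e.
by rewrite -(pair_count_conj s' i j yu) e' pair_count_conj.
Qed.

(** Such a [u] fixes every position [k] in a block of [W]: otherwise [k] and [u k] are incomparable,
    so their partners share a block outside [W], and two parallel pairs of this kind are
    excluded. *)
Lemma wsign_young_colored u : young c u -> wsign C W nu u = 1.
Proof.
move=> yu; have [yb _] := young_colored yu; have [_ anti] := cw.
have [ms _ inj] := ps.
rewrite /wsign (_ : restr_young _ _ _ = 1%g) ?odd_perm1 //.
apply/permP => k; rewrite restr_youngE // perm1; case: ifPn => //= kW.
have [bk wk] : b (u k) = b k /\ w (u k) = w k.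
  by apply/colored_blockP; have /youngP := yu.
apply/eqP/negPn/negP => ne; have ne' : k != u k by rewrite eq_sym.
have := anti _ _ ne wk; have := anti _ _ ne' (esym wk).
rewrite /WW_step /= bk !leqnn eqxx kW /=.
case: ltngtP => //= e _ skW.
case/eqP: ne'; apply: inj; rewrite ?bk ?e //.
by rewrite kW (negbTE skW).
Qed.

(** Each contributing [u] factors as [v] in the coloured Young subgroup times a Young permutation
    commuting with [s]. Both have [wsign] 1, so the coefficient is the number of contributing
    permutations. *)
Lemma PT_coef_diag : PT s w != 0.
Proof.
have [ms _ _] := ps; have [ws _] := cw.
have ww : perm_word s w = w by apply/ffunP => k; rewrite ffunE ws.
pose A := [pred u | young b u && (perm_word (u * s * u^-1)%g w == w)].
have -> : PT s w = #|A|%:R.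
  rewrite PT_coefE -sumr_const big_mkcond [RHS]big_mkcond.
  apply: eq_bigr => u _; rewrite inE; case: ifP => //= yu.
  case: eqP => [e|_]; last by rewrite mulr0.
  have [_ eq_Phi] := colored_matching_min (matching_conjg u ms) e.
  have [v yv e'] := eq_Phi (Phi_conj s yu); have [ybv _] := young_colored yv.
  have yz : young b (v^-1 * u)%g by apply: youngM => //; apply: youngV.
  have zs : (v^-1 * u * s = s * (v^-1 * u))%g.
    have := congr1 (fun x => v^-1 * x * u)%g e'.
    by rewrite !mulgA mulVg mul1g mulgKV -!mulgA.
  rewrite mulr1 -(mulKVg v u) wsignM // wsign_young_colored // mul1r.
  by rewrite /wsign (odd_restr_centralizer ps yz zs).
rewrite pnatr_eq0 -lt0n; apply/card_gt0P; exists 1%g.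
by rewrite inE /= young1 invg1 mulg1 mul1g ww eqxx.
Qed.

End Triangularity.

(** In a vanishing combination, the functional of an index with largest [m] among the nonzero
    coefficients annihilates every other term. *)
Lemma free_triangular (K : fieldType) (V : vectType K) (I : eqType) (s : seq I)
    (f : I -> V) (m : I -> int) :
  uniq s ->
  (forall i, i \in s -> exists phi : {linear V -> K^o}, phi (f i) != 0 /\
     {in s, forall j, phi (f j) != 0 -> i = j \/ m i < m j}) ->
  free (map f s).
Proof.
move=> us tri.
apply/(@freeP _ _ _ (in_tuple (map f s))) => k kf i1.
apply/eqP/negPn/negP => nz1.
have x0 : I by case: (s) i1 {k kf nz1} => [[]//|y].
pose x (i : 'I_(size (map f s))) := nth x0 s i.
have xs (i : 'I_(size (map f s))) : x i \in s by rewrite mem_nth // -(size_map f).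
have fx (i : 'I_(size (map f s))) : (map f s)`_i = f (x i) by rewrite (nth_map x0) // -(size_map f).
have [i0 nz0 max0] := @arg_maxP _ _ _ i1 (fun i => k i != 0) (fun i => m (x i)) nz1.
have [phi [diag off]] := tri _ (xs i0).
have /eqP := congr1 phi kf.
rewrite linear0 linear_sum (bigD1 i0) //= big1 => [|j ne]; last first.
  apply/eqP; rewrite linearZ /= fx scaler_eq0; apply/norP => -[nzj].
  case/(off _ (xs j)) => [e|lt].
    move/eqP: e; rewrite /x nth_uniq -?(size_map f) // => /eqP/val_inj e.
    by rewrite e eqxx in ne.
  by have /= := max0 j nzj; rewrite leNgt lt.
by rewrite addr0 linearZ /= fx scaler_eq0 (negbTE nz0) (negbTE diag).
Qed.

(* Linear independence and spanning combined *)
Local Close Scope ring_scope.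
Local Close Scope mset_scope.
Local Close Scope fset_scope.
Local Open Scope mset_scope.

Theorem theorem8p5 (R : realType) (W : {pred nat}) (l n : nat) (nu : seq nat)
    (hnu : sumn nu = (2 * n)%N)
    (tau : {mset nat * nat} -> 'S_(2 * n))
    (htau : forall M, MO W nu 0 M -> represents nu (tau M) M) :
  is_family_basis (fun M : {mset nat * nat} => MO W nu 0 M /\ (ell W M <= l)%N)
    (@TOM R l (2 * n) W nu tau) (@PiFO R l (2 * n) W nu).
Proof.
have proper_tau M : MO W nu 0 M -> proper_matching (@block_of (2 * n) nu) W (tau M).
  by move=> MM; apply: (MO_proper hnu MM); apply: htau.
have match_tau M : MO W nu 0 M -> matching [set: 'I_(2 * n)] (tau M).
  by case/proper_tau.
have mset_tau M : MO W nu 0 M -> mset_of nu (tau M) = M.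
  by move/htau/(mset_of_eq hnu).
split=> [s us sP|v].
  apply: (@free_triangular _ _ _ _ _ (fun M => Phi nu (tau M))) => // M /sP[MM ellM].
  have [w cw] : exists w : {ffun 'I_(2 * n) -> 'I_l}, antichain_coloring W nu (tau M) w.
    by apply: antichain_coloring_exists; [apply: proper_tau | rewrite mset_tau].
  exists (coef w); split; first exact: PT_coef_diag (proper_tau _ MM) cw.
  move=> M' /sP[MM' _] nz.
  have [|lt|e] := PT_coef_triangular hnu (proper_tau _ MM) cw (s' := tau M') _ nz.
  - exact: match_tau.
  - by right.
  left; rewrite -(mset_tau _ MM) -(mset_tau _ MM').
  by apply/msetP => -[i j]; rewrite !mset_of_count e.
split=> [[u Fu ->]|[s sP]].
  exists (basis_msets l (2 * n) W nu) => [M|].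
    by rewrite mem_filter => /andP[/asboolP].
  apply: linear_span_sub (FO_TO_span Fu) => x /mapP[t].
  by rewrite mem_filter => /andP[mt _] ->; apply: PT_span.
have -> : map (@TOM R l (2 * n) W nu tau) s
    = map (linfun (galg_act (Pi R[i] (2 * n) W nu))) [seq TO R[i] l (tau M) | M <- s].
  by rewrite -map_comp; apply: eq_map => M; rewrite /= lfunE.
(* A combination of the [TOM] is the image of a combination of basic invariants, and the vectors
   fixed by a given [U] form a subspace. *)
rewrite -limg_span => /memv_imgP[u us ->]; exists u; last by rewrite lfunE.
move=> U UU; rewrite -[LHS](lfunE (mx_act (map_mx (real_complex R) U))).
apply/fixedSpaceP; apply: (subvP _ _ us); apply/span_subvP => _ /mapP[M Ms ->].
apply/fixedSpaceP; rewrite lfunE; apply: FO_TO UU.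
by apply: match_tau; case: (sP _ Ms).
Qed.
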